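(* Let $(\varphi_t)_t$ be a flow on a measurable space $\mathcal M$ preserving an infinite ($\sigma$-finite) measure $\nu$, and assume that $(\mathcal M,(\varphi_t)_t,\nu)$ is conservative and ergodic. Let $x_0\in\mathbb R^d$. Let $\tilde f:\mathbb R^d\times\mathcal M\to\mathbb R^d$ be measurable, uniformly bounded, Lipschitz continuous in its first variable (uniformly) and $\nu$-integrable in its second variable, and assume that the Lipschitz constant of $\tilde f$ in its first variable, as a function of $\omega\in\mathcal M$, is $\nu$-integrable. Let $X^\epsilon_t(x_0,\omega)$ be the solution of $$\frac{dX_t^\epsilon}{dt}(x_0,\omega)=\tilde f(X^\epsilon_t(x_0,\omega),\varphi_{t/\epsilon}(\omega)),\qquad X_0^\epsilon(x_0,\omega)=x_0.$$ (1) For all $T>0$, for $\nu$-almost every $\omega\in\mathcal M$, as $\epsilon\to0$, $$\sup_{t\in[0,T]}\Big|X^\epsilon_t(x_0,\omega)-x_0-\int_0^t\tilde f(x_0,\varphi_{s/\epsilon}(\omega))\,ds\Big|=o\Big(\sup_{t\in[0,T]}\Big|\int_0^t\tilde f(x_0,\varphi_{s/\epsilon}(\omega))\,ds\Big|\Big).$$ (2) If moreover there exist positive numbers $(\mathfrak b_t)_{t>0}$ and a non-degenerate real valued random variable $Y$ such that, for every $g\in L^1(\nu)$, $$\mathfrak b_t\int_0^tg\circ\varphi_s\,ds\longrightarrow\int_{\mathcal M}g\,d\nu\;Y\qquad(t\to+\infty)$$ strongly in distribution with respect to $\nu$, then, for every $t>0$, $$\frac{\mathfrak b_{t/\epsilon}}{\epsilon}\big(X_t^\epsilon(x_0,\cdot)-x_0\big)\longrightarrow\int_{\mathcal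 M}\tilde f(x_0,\cdot)\,d\nu\;Y\qquad(\epsilon\to0)$$ strongly in distribution with respect to $\nu$. (3) If $x_0$ is such that there exist a family of positive numbers $(\mathfrak a_\epsilon)_{\epsilon>0}$ and a continuous process $Z$ such that, for all $S>0$, $$\Big(\mathfrak a_\epsilon\int_0^{t/\epsilon}\tilde f(x_0,\varphi_s(\cdot))\,ds\Big)_{t\in[0,S]}\longrightarrow(Z_t)_{t\in[0,S]}\qquad(\epsilon\to0)$$ strongly in distribution with respect to $\nu$ for the uniform norm, then, for all $S>0$, $$\Big(\frac{\mathfrak a_\epsilon}{\epsilon}(X_t^\epsilon(x_0,\cdot)-x_0)\Big)_{t\in[0,S]}\longrightarrow(Z_t)_{t\in[0,S]}\qquad(\epsilon\to0)$$ strongly in distribution with respect to $\nu$ for the uniform norm.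
   Context: Strong convergence in distribution with respect to $\nu$ means convergence in distribution with respect to every probability measure absolutely continuous with respect to $\nu$. *)

(* Defs.v *)
From HB Require Import structures.
From mathcomp Require Import all_boot all_order all_algebra.
From mathcomp Require Import all_classical all_reals all_analysis.

Set Implicit Arguments.
Unset Strict Implicit.
Unset Printing Implicit Defensive.

Import Order.TTheory GRing.Theory Num.Theory.
Import numFieldNormedType.Exports.

Local Open Scope classical_set_scope.
Local Open Scope ring_scope.

Notation borel T := (g_sigma_algebraType (@open T)).

Section vector_integral.
Context {d : measure_display} {M : measurableType d} {R : realType}.

Definition vintegral n (mu : {measure set M -> \bar R}) (D : set M)
    (f : M -> 'rV[R]_n) : 'rV[R]_n :=
  \row_i \int[mu]_(x in D) f x ord0 i.

End vector_integral.

Section flows.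
Context {d : measure_display} {M : measurableType d} {R : realType}.
Variable phi : R -> M -> M.

Record is_flow : Prop := IsFlow {
  flow0 : forall w, phi 0 w = w ;
  flowD : forall s t w, phi (s + t) w = phi s (phi t w) ;
  measurable_flow :
    measurable_fun [set: measurableTypeR R * M] (fun p => phi p.1 p.2) }.

Variable nu : {measure set M -> \bar R}.

Definition measure_preserving : Prop :=
  forall t A, measurable A -> nu (phi t @^-1` A) = nu A.

(* In continuous time, a wandering set is one which, up to null sets, no
   longer meets its translates after some finite time; nearby translates of
   it may overlap. *)
Definition wandering (W : set M) : Prop :=
  measurable W /\
  exists T : R, forall t, T < t -> nu (W `&` phi t @^-1` W) = 0%E.

Definition conservative : Prop := forall W, wandering W -> nu W = 0%E.

Definition ergodic : Prop :=
  forall A, measurable A -> (forall t, phi t @^-1` A = A) ->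
  nu A = 0%E \/ nu (~` A) = 0%E.

End flows.

Definition lipschitz_constant (R : realType) (V W : normedModType R)
    (g : V -> W) : R :=
  sup [set r | exists x y, x != y /\ r = `|g x - g y| / `|x - y|].

Section ode.
Context {R : realType} {n : nat}.

Definition absolutely_continuous (a b : R) (x : R -> 'rV[R]_n) : Prop :=
  forall e : R, 0 < e -> exists2 delta : R, 0 < delta &
    forall (N : nat) (u v : 'I_N -> R),
      (forall i, [/\ a <= u i, u i <= v i & v i <= b]) ->
      trivIset [set: 'I_N] (fun i => `]u i, v i[%classic) ->
      \sum_i (v i - u i) < delta ->
      \sum_i `|x (v i) - x (u i)| < e.

(* Solutions on [0, +oo[ of x' = F(t, x), x(0) = x0, in the sense of
   Caratheodory: F is only assumed to be measurable in t, so that the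
   equation is required at almost every time. *)
Definition ode_solution (F : R -> 'rV[R]_n -> 'rV[R]_n) (x0 : 'rV[R]_n)
    (x : R -> 'rV[R]_n) : Prop :=
  [/\ x 0 = x0,
      forall b : R, 0 < b -> absolutely_continuous 0 b x &
      {ae (@lebesgue_measure R),
        forall t : R, 0 < t -> is_derive t (1 : R) x (F t (x t))}].

End ode.

Section convergence_in_distribution.
Context {R : realType}.

(* Random elements of the subspace C of T. As X takes its values in C, it is
   the same to consider the Borel sets of T or those of C, which are their
   traces on C. *)
Definition random_element (T : topologicalType) (C : set T)
    d (Om : measurableType d) (X : Om -> T) : Prop :=
  (forall w, C (X w)) /\
  (forall B, <<s @open T >> B -> measurable (X @^-1` B)).

(* Convergence in distribution, along the filter F, of the random elements
   X_i of the subspace C of T (defined on the probability space (Om, P))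
   to the random element Y of C (defined on (Om', P')). *)
Definition cvg_in_distribution (T : topologicalType) (C : set T)
    (I : Type) (F : set_system I)
    d (Om : measurableType d) (P : probability Om R) (X : I -> Om -> T)
    d' (Om' : measurableType d') (P' : probability Om' R) (Y : Om' -> T) :
    Prop :=
  [/\ \forall i \near F, random_element C (X i),
      random_element C Y &
      forall h : T -> R, {within C, continuous h} ->
        (exists K : R, forall x, C x -> `|h x| <= K) ->
        \int[P]_w h (X i w) @[i --> F] --> \int[P']_w h (Y w)].

Definition strong_cvg_in_distribution (T : topologicalType) (C : set T)
    (I : Type) (F : set_system I)
    d (M : measurableType d) (nu : {measure set M -> \bar R})
    (X : I -> M -> T)
    d' (Om' : measurableType d') (P' : probability Om' R) (Y : Om' -> T) :
    Prop :=
  forall mu : probability M R, mu `<< nu ->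
    cvg_in_distribution C F mu X P' Y.

(* C([0, S], R^n) with the uniform norm: the functions continuous on [0, S],
   in the space of all functions R -> R^n with the topology of uniform
   convergence on [0, S], in which two functions which agree on [0, S] are
   indistinguishable. *)
Definition path_space (n : nat) (S : R) : topologicalType :=
  {uniform` `[0, S] -> 'rV[R]_n}.

Definition continuous_paths (n : nat) (S : R) : set (path_space n S) :=
  [set x : R -> 'rV[R]_n | {within `[0, S], continuous x}].

(* Convergence of the processes X_i = (X_i(t))_t to Z on [0, S], strongly in
   distribution with respect to nu, for the uniform norm. *)
Definition strong_cvg_in_distribution_unif (n : nat) (S : R)
    (I : Type) (F : set_system I)
    d (M : measurableType d) (nu : {measure set M -> \bar R})
    (X : I -> R -> M -> 'rV[R]_n)
    d' (Om' : measurableType d') (P' : probability Om' R)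
    (Z : R -> Om' -> 'rV[R]_n) : Prop :=
  @strong_cvg_in_distribution (path_space n S) (@continuous_paths n S) I F
    d M nu (fun i w => X i ^~ w) d' Om' P' (fun w => Z ^~ w).

Definition continuous_process (n : nat) d (Om : measurableType d)
    (Z : R -> Om -> 'rV[R]_n) : Prop :=
  (forall t, 0 <= t -> measurable_fun setT (Z t : Om -> borel 'rV[R]_n)) /\
  (forall w, {within `[0, +oo[, continuous (Z ^~ w)}).

Definition nondegenerate_RV d (Om : measurableType d) (P : probability Om R)
    (Y : Om -> R) : Prop :=
  ~ exists c : R, {ae P, forall w, Y w = c}.

End convergence_in_distribution.

(* Main.v *)
Require Import Defs.
From HB Require Import structures.
From mathcomp Require Import all_boot all_order all_algebra.
From mathcomp Require Import all_classical all_reals all_analysis.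
From mathcomp Require Import measurable_realfun ring lra.

Set Implicit Arguments.
Unset Strict Implicit.
Unset Printing Implicit Defensive.

Import Order.TTheory GRing.Theory Num.Theory.
Import numFieldNormedType.Exports.

Local Open Scope classical_set_scope.
Local Open Scope ring_scope.

(** The solution X of X' t = f (X t) (phi (t / e) w) is compared with the integral
    W t = \int_0^t f x0 (phi (s / e) w) ds of the field frozen at x0. Let
    E = X - x0 - W, and let L w be the Lipschitz constant of f in its first
    variable. At almost every time, |E'| <= L (phi (t / e) w) * |X - x0|. With
    m = sup |E| and S = sup |W| over [0, T], this gives m <= dl * (m + S), where
    dl = \int_0^T L (phi (s / e) w) ds, and so m <= 2 * dl * S as soon as
    dl <= 1 / 2 ([averaging_error]). The integration of the bound on E' holds
    because E is absolutely continuous, though the equation is satisfied at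
    almost every time only ([absolutely_continuous_comparison]).

    The number dl is e times the integral of L along the orbit up to time T / e.
    It tends to 0 almost everywhere ([infinite_ergodic_average]): for a > 0, the
    set where the integral up to time n exceeds a * n by an unbounded amount is
    invariant, and its measure is finite by a maximal inequality; since nu is
    ergodic and infinite, it is null. The first assertion follows.

    For the two limits in distribution, fix a probability measure absolutely
    continuous with respect to nu. The expectation of dl tends to 0, while S,
    after normalization, is bounded by random variables that converge in
    distribution, and are therefore tight. The rescaled solution and the rescaled
    integral W are then close in probability, and have the same limit
    ([tight_mul_cvg0] and [slutsky]). In the last assertion the convergence of
    W is the hypothesis. In the second one the hypothesis is about scalar
    functions: the coordinates of f x0 are replaced by multiples of one function
    of integral 1, the differences having integral 0, hence a negligible
    normalized integral.

    These statements also require that X e t and the paths of X be measurable in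
    w. The value X e t w is a limit of Euler schemes ([measurable_solution]), and
    a random continuous path is measurable for the uniform norm when its
    coordinates are, since the space of paths is separable
    ([random_element_path]). *)

(** * Lebesgue integrals over intervals *)

Section lebesgue_interval_integrals.
Context {R : realType}.
Local Notation leb := (@lebesgue_measure R).
Implicit Types (h : R -> R) (a b c r K : R).

Lemma bounded_integrable_itv h K a b :
  measurable_fun [set: R] h -> (forall x, `|h x| <= K) ->
  leb.-integrable `[a, b] (EFin \o h).
Proof.
move=> mh hK; apply: measurable_bounded_integrable => //.
- by rewrite /= lebesgue_measure_itv/=; case: ifPn => // _; rewrite -EFinB ltry.
- exact: measurable_funTS.
- exists K; split; first by rewrite num_real.
  by move=> y Ky x _ /=; rewrite (le_trans (hK x))// ltW.
Qed.

Lemma measurable_affine c r :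
  measurable_fun [set: measurableTypeR R]
    (fun x => c * x + r : measurableTypeR R).
Proof. by apply: measurable_funD => //; exact: measurable_funM. Qed.

Lemma lebesgue_measure_affine c r (A : set R) : 0 < c -> measurable A ->
  leb A = (c%:E * leb ((fun x => c * x + r)%R @^-1` A))%E.
Proof.
move=> c0 mA.
pose F : measurableTypeR R -> measurableTypeR R := fun x => c * x + r.
have mF : measurable_fun [set: measurableTypeR R] F := measurable_affine c r.
pose FM := isMeasurableFun.Build _ _ _ _ _ mF.
pose FP : {mfun _ >-> _} := HB.pack F FM.
apply: (@lebesgue_measure_unique R
  (mscale (NngNum (ltW c0)) (pushforward leb FP))) => //.
move=> _ [[a b]] _ <-; rewrite /mscale /pushforward /=.
rewrite [RHS]/(c%:E * leb (F @^-1` [set` `]a, b]]))%E.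
have -> : F @^-1` [set` `]a, b]] = `](a - r) / c, (b - r) / c]%classic.
  apply/seteqP; split => x /=; rewrite !in_itv/= /F.
    by rewrite ltr_pdivrMr// ler_pdivlMr// ltrBlDr lerBrDr [x * c]mulrC.
  by rewrite ltr_pdivrMr// ler_pdivlMr// ltrBlDr lerBrDr [x * c]mulrC.
rewrite !lebesgue_measure_itv/= !lte_fin ltr_pM2r ?invr_gt0// ltrBlDr subrK.
case: ifPn => _; last by rewrite /= mulr0.
by rewrite /= -EFinB; congr EFin; field; rewrite gt_eqF.
Qed.

(** The two changes of time needed below are affine: the scaling s |-> s / e
    and the translations along the flow. The image of the Lebesgue measure
    is known by uniqueness; positive and negative parts are transported
    separately. *)
Lemma Rintegral_affine h K a b c r : 0 < c ->
  measurable_fun [set: R] h -> (forall x, `|h x| <= K) ->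
  \int[leb]_(x in `[c * a + r, c * b + r]) h x =
  c * \int[leb]_(x in `[a, b]) h (c * x + r).
Proof.
move=> c0 mh hK.
pose F : measurableTypeR R -> measurableTypeR R := fun x => c * x + r.
have mF : measurable_fun [set: measurableTypeR R] F := measurable_affine c r.
pose FM := isMeasurableFun.Build _ _ _ _ _ mF.
pose FP : {mfun _ >-> _} := HB.pack F FM.
have pre : F @^-1` `[c * a + r, c * b + r] = `[a, b]%classic.
  apply/seteqP; split => x /=; rewrite !in_itv/= /F !lerD2r !ler_pM2l//.
have step (g : R -> R) : measurable_fun [set: R] g -> (forall x, 0 <= g x) ->
  (forall x, `|g x| <= K) ->
  \int[leb]_(x in `[c * a + r, c * b + r]) g x =
  c * \int[leb]_(x in `[a, b]) g (c * x + r).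
  move=> mg g0 gK; rewrite /Rintegral.
  rewrite (eq_measure_integral
    (mscale (NngNum (ltW c0)) (pushforward leb FP))); last first.
    by move=> A mA _; exact: (lebesgue_measure_affine r c0 mA).
  have mg' (D : set R) : measurable D -> measurable_fun D (EFin \o g).
    by move=> mD; apply/measurable_EFinP; apply: measurable_funTS.
  rewrite ge0_integral_mscale//; last 2 first.
  - exact: mg'.
  - by move=> x _; rewrite lee_fin.
  rewrite ge0_integral_pushforward//; last 2 first.
  - exact: mg'.
  - by move=> x _; rewrite lee_fin.
  rewrite /= pre fineM//.
  apply: integrable_fin_num => //; apply: (bounded_integrable_itv (K := K)) => //.
  by apply: measurableT_comp.
have mF' : measurable_fun [set: R] (fun x => h (c * x + r)).
  exact: (measurableT_comp mh mF).
have K0 : 0 <= K by rewrite (le_trans _ (hK 0)).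
have E : h = fun x => (h^\+ x - h^\- x).
  by apply/funext => x; rewrite -[in LHS](funrposBneg h).
have PK x : `|h^\+ x| <= K.
  rewrite ger0_norm ?funrpos_ge0// /funrpos ge_max K0 andbT.
  by rewrite (le_trans (ler_norm _)).
have NK x : `|h^\- x| <= K.
  rewrite ger0_norm ?funrneg_ge0// /funrneg ge_max K0 andbT.
  by rewrite (le_trans (ler_norm _))// normrN.
have mP : measurable_fun [set: R] h^\+ by exact: measurable_funrpos.
have mN : measurable_fun [set: R] h^\- by exact: measurable_funrneg.
have Ec x : h (c * x + r) = h^\+ (c * x + r) - h^\- (c * x + r).
  by rewrite {1}E.
rewrite {1}E; under [in RHS]eq_Rintegral do rewrite Ec.
rewrite !RintegralB//; first by rewrite !step// mulrBr.
- apply: (bounded_integrable_itv (K := K)) => //; exact: (measurableT_comp mP mF).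
- apply: (bounded_integrable_itv (K := K)) => //; exact: (measurableT_comp mN mF).
- exact: (bounded_integrable_itv (K := K)).
- exact: (bounded_integrable_itv (K := K)).
Qed.

Lemma Rintegral_itv_split h K a b c : a <= b -> b <= c ->
  measurable_fun [set: R] h -> (forall x, `|h x| <= K) ->
  \int[leb]_(x in `[a, c]) h x =
  \int[leb]_(x in `[a, b]) h x + \int[leb]_(x in `[b, c]) h x.
Proof.
move=> ab bc mh hK.
have := @Rintegral_itvB R h (BLeft a) (BRight c) b
  (bounded_integrable_itv _ _ mh hK).
rewrite !bnd_simp => /(_ ab bc) /(canRL (subrK _)) ->.
rewrite addrC; congr (_ + _); rewrite Rintegral_itv_obnd_cbnd//.
apply: integrableS (bounded_integrable_itv b c mh hK) => //.
by apply: subset_itvr; rewrite bnd_simp.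
Qed.

Lemma normr_Rintegral_itv h K a b : a <= b ->
  measurable_fun [set: R] h -> (forall x, `|h x| <= K) ->
  `|\int[leb]_(x in `[a, b]) h x| <= K * (b - a).
Proof.
move=> ab mh hK.
apply: (le_trans (le_normr_Rintegral _ _)) => //.
  exact: (bounded_integrable_itv _ _ mh hK).
have -> : K * (b - a) = \int[leb]_(x in `[a, b]) (fun=> K) x.
  rewrite Rintegral_cst//= lebesgue_measure_itv/= lte_fin.
  by move: ab; rewrite le_eqVlt => /predU1P[->|->//]; rewrite ltxx subrr.
have K0 : 0 <= K by rewrite (le_trans _ (hK 0)).
apply: le_Rintegral => //.
- apply: (bounded_integrable_itv (K := K)) => [|x]; last by rewrite normr_id.
  exact: measurableT_comp.
- by apply: (bounded_integrable_itv (K := K)) => // x; rewrite ger0_norm.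
Qed.

End lebesgue_interval_integrals.

(** * Expectations of bounded random variables *)

Section bounded_random_variables.
Context {R : realType} {d : measure_display} {Om : measurableType d}.
Variable P : probability Om R.
Implicit Types (h : Om -> R) (K : R).

Lemma bounded_integrable_probability h K : measurable_fun [set: Om] h ->
  (forall w, `|h w| <= K) -> P.-integrable [set: Om] (EFin \o h).
Proof.
move=> mh hK; apply: measurable_bounded_integrable => //.
  by rewrite -ge0_fin_numE ?fin_num_measure.
exists K; split; first by rewrite num_real.
by move=> y Ky w _ /=; rewrite (le_trans (hK w))// ltW.
Qed.

Lemma le_expectation h1 h2 K1 K2 :
  measurable_fun [set: Om] h1 -> (forall w, `|h1 w| <= K1) ->
  measurable_fun [set: Om] h2 -> (forall w, `|h2 w| <= K2) ->
  (forall w, h1 w <= h2 w) -> \int[P]_w h1 w <= \int[P]_w h2 w.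
Proof.
move=> m1 b1 m2 b2 h12.
by apply: le_Rintegral => //; apply: bounded_integrable_probability; eassumption.
Qed.

Lemma bounded_convergence (h_ : nat -> Om -> R) h K :
  (forall k, measurable_fun [set: Om] (h_ k)) -> measurable_fun [set: Om] h ->
  (forall k w, `|h_ k w| <= K) ->
  {ae P, forall w, h_ k w @[k --> \oo] --> h w} ->
  \int[P]_w h_ k w @[k --> \oo] --> \int[P]_w h w.
Proof.
move=> mh_ mh hK hcv.
have K0 w : 0 <= K := le_trans (normr_ge0 _) (hK 0%N w).
have [] := @dominated_convergence _ _ _ P [set: Om] measurableT
  (fun k => EFin \o h_ k) (EFin \o h) (cst K%:E).
- by move=> k; exact/measurable_EFinP.
- exact/measurable_EFinP.
- by apply: filterS hcv => w hw _; apply/cvg_EFin => //; exact: nearW.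
- apply: (@bounded_integrable_probability (cst K) K) => // w /=.
  by rewrite ger0_norm// (K0 w).
- by apply: aeW => w k _; rewrite /= lee_fin.
move=> inth _; rewrite -(fineK (integrable_fin_num measurableT inth)).
by move=> /fine_cvgP[_]; exact.
Qed.

End bounded_random_variables.

(** * Integrals along the orbits of a flow *)

Section parametric_integral.
Context {R : realType} {d : measure_display} {T : measurableType d}.
Local Notation leb := (@lebesgue_measure R).

Lemma measurable_fun_slice (F : R * T -> R) (w : T) :
  measurable_fun [set: measurableTypeR R * T] F ->
  measurable_fun [set: R] (fun s => F (s, w)).
Proof.
by move=> mF; apply: (measurableT_comp mF); exact: measurable_pair2.
Qed.

(** F + K is nonnegative, so that Tonelli's theorem gives the measurability
    in w of its integral over the interval. *)
Lemma measurable_Rintegral_param (F : R * T -> R) (K a b : R) : a <= b ->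
  measurable_fun [set: measurableTypeR R * T] F -> (forall p, `|F p| <= K) ->
  measurable_fun [set: T] (fun w => \int[leb]_(s in `[a, b]) F (s, w)).
Proof.
move=> ab mF FK.
have K0 (p : R * T) : 0 <= K by rewrite (le_trans _ (FK p)).
pose G (p : measurableTypeR R * T) : \bar R :=
  ((F p + K) * \1_(`[a, b]%classic) p.1)%:E.
have G0 p : (0 <= G p)%E.
  rewrite lee_fin mulr_ge0// -lerBlDr sub0r.
  by have := FK p; rewrite ler_norml => /andP[].
have mG : measurable_fun [set: measurableTypeR R * T] G.
  apply/measurable_EFinP; apply: measurable_funM.
    by apply: measurable_funD.
  apply: (measurableT_comp (f := \1_(`[a, b]%classic) : R -> R)).
    by apply: measurable_indic.
  exact: measurable_fst.
have : measurable_fun [set: T] (fubini_G leb G).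
  exact: measurable_fun_fubini_tonelli_G.
move=> mfG.
rewrite (_ : (fun w => _) = fun w => fine (fubini_G leb G w) - K * (b - a)).
  apply: measurable_funB => //.
  by apply: measurableT_comp mfG; exact: fine_measurable.
apply/funext => w; rewrite /fubini_G /G.
have E : (\int[leb]_x ((F (x, w) + K) * \1_(`[a, b]%classic) x)%:E)%E =
    (\int[leb]_(x in `[a, b]) (F (x, w) + K)%:E)%E.
  rewrite [RHS]integral_mkcond; apply: eq_integral => x _.
  rewrite patchE indicE; case: ifPn => _; first by rewrite mulr1.
  by rewrite mulr0.
rewrite [X in fine X]E -[fine _]/(Rintegral leb `[a, b] (fun x => F (x, w) + K)).
rewrite RintegralD//.
- rewrite Rintegral_cst//= lebesgue_measure_itv/= lte_fin.
  rewrite -addrA -[LHS]addr0; congr (_ + _).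
  move: ab; rewrite le_eqVlt => /predU1P[->|->/=]; last by rewrite subrr.
  by rewrite ltxx !subrr.
- apply: bounded_integrable_itv; first exact: measurable_fun_slice.
  by move=> x; exact: FK.
- apply: (bounded_integrable_itv (K := K)) => // x.
  by rewrite ger0_norm// (K0 (x, w)).
Qed.

End parametric_integral.

Section orbit_integral.
Context {R : realType} {d : measure_display} {M : measurableType d}.
Local Notation leb := (@lebesgue_measure R).
Variable phi : R -> M -> M.
Hypothesis hphi : is_flow phi.

Definition orbit_integral (g : M -> R) (t : R) (w : M) : R :=
  \int[leb]_(s in `[0, t]) g (phi s w).

Lemma measurable_along_orbit (g : M -> R) w : measurable_fun [set: M] g ->
  measurable_fun [set: R] (fun s => g (phi s w)).
Proof.
move=> mg; apply: (@measurable_fun_slice _ _ _ (fun p => g (phi p.1 p.2))).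
exact: (measurableT_comp mg (measurable_flow hphi)).
Qed.

Variables (g : M -> R) (K : R).
Hypotheses (mg : measurable_fun [set: M] g) (gK : forall w, `|g w| <= K).

Lemma orbit_integral0 w : orbit_integral g 0 w = 0.
Proof. by rewrite /orbit_integral set_itv1 Rintegral_set1. Qed.

Lemma orbit_integralD s t w : 0 <= s -> 0 <= t ->
  orbit_integral g (s + t) w = orbit_integral g s w + orbit_integral g t (phi s w).
Proof.
move=> s0 t0; rewrite /orbit_integral.
rewrite (@Rintegral_itv_split _ _ K 0 s (s + t)) ?lerDl//; last first.
  exact: measurable_along_orbit.
congr (_ + _).
have := @Rintegral_affine _ (fun s => g (phi s w)) K 0 t 1 s ltr01
  (measurable_along_orbit _ mg) (fun x => gK _).
rewrite mulr0 add0r !mul1r addrC => ->.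
by apply: eq_Rintegral => x _; rewrite mul1r (flowD hphi).
Qed.

Lemma normr_orbit_integral t w : 0 <= t -> `|orbit_integral g t w| <= K * t.
Proof.
move=> t0; rewrite -[t in leRHS]subr0.
by apply: normr_Rintegral_itv => //; exact: measurable_along_orbit.
Qed.

Lemma measurable_orbit_integral t : 0 <= t ->
  measurable_fun [set: M] (orbit_integral g t).
Proof.
move=> t0.
apply: (@measurable_Rintegral_param _ _ _ (fun p => g (phi p.1 p.2)) K) => //.
exact: (measurableT_comp mg (measurable_flow hphi)).
Qed.

Hypothesis g0 : forall w, 0 <= g w.

Lemma orbit_integral_ge0 t w : 0 <= orbit_integral g t w.
Proof. by apply: Rintegral_ge0. Qed.

Lemma le_orbit_integral s t w : 0 <= s -> s <= t ->
  orbit_integral g s w <= orbit_integral g t w.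
Proof.
move=> s0 st; rewrite -(subrKC s t) orbit_integralD ?subr_ge0//.
by rewrite lerDl orbit_integral_ge0.
Qed.

Variable nu : {measure set M -> \bar R}.
Hypothesis phi_preserving : measure_preserving phi nu.
Hypothesis nu_sigma_finite : sigma_finite [set: M] nu.

Lemma integral_preserving (h : M -> \bar R) t : measurable_fun [set: M] h ->
  (forall w, 0 <= h w)%E ->
  (\int[nu]_w h (phi t w) = \int[nu]_w h w)%E.
Proof.
move=> mh h0.
have mF : measurable_fun [set: M] (phi t).
  exact: (measurableT_comp (measurable_flow hphi) (measurable_pair1 t)).
pose FM := isMeasurableFun.Build _ _ _ _ _ mF.
pose FP : {mfun _ >-> _} := HB.pack (phi t) FM.
rewrite -[LHS](@ge0_integral_pushforward _ _ _ _ _ FP _ nu setT)//.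
by apply: eq_measure_integral => A mA _; exact: phi_preserving.
Qed.

(** Tonelli's theorem exchanges the two integrals, and for each s the
    invariance of nu removes phi s. *)
Lemma integral_orbit_integral t : 0 <= t ->
  (\int[nu]_w (orbit_integral g t w)%:E = t%:E * \int[nu]_w (g w)%:E)%E.
Proof.
move=> t0.
pose nu1 := isSFinite.Build _ _ _ _ (sfinite_measure_sigma_finite nu_sigma_finite).
pose nu2 := isSigmaFinite.Build _ _ _ _ nu_sigma_finite.
pose nuS : {sigma_finite_measure set M -> \bar R} :=
  HB.pack (nu : set M -> \bar R) nu1 nu2 (Measure.class nu).
pose G (p : measurableTypeR R * M) : \bar R :=
  (g (phi p.1 p.2) * \1_(`[0, t]%classic) p.1)%:E.
have G0 p : (0 <= G p)%E by rewrite lee_fin mulr_ge0.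
have mG : measurable_fun [set: measurableTypeR R * M] G.
  apply/measurable_EFinP; apply: measurable_funM.
    exact: (measurableT_comp mg (measurable_flow hphi)).
  apply: (measurableT_comp (f := \1_(`[0, t]%classic) : R -> R)).
    by apply: measurable_indic.
  exact: measurable_fst.
transitivity (\int[nuS]_w \int[leb]_s G (s, w))%E.
  apply: eq_integral => w _; rewrite /orbit_integral /Rintegral fineK; last first.
    apply: integrable_fin_num => //; apply: (bounded_integrable_itv (K := K)) => //.
    exact: measurable_along_orbit.
  rewrite integral_mkcond; apply: eq_integral => x _.
  rewrite /G/= patchE indicE; case: ifPn => _; first by rewrite mulr1.
  by rewrite mulr0.
rewrite -fubini_tonelli//.
transitivity (\int[leb]_(s in `[0%R, t]) \int[nu]_w (g w)%:E)%E.
  rewrite [RHS]integral_mkcond; apply: eq_integral => s _.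
  rewrite patchE /G/= indicE; case: ifPn => _.
    under eq_integral do rewrite mulr1.
    rewrite (integral_preserving (h := EFin \o g)) //.
      exact/measurable_EFinP.
  by rewrite integral0_eq// => w _; rewrite mulr0.
rewrite integral_cst//= lebesgue_measure_itv/= lte_fin muleC.
move: t0; rewrite le_eqVlt => /predU1P[<-|->].
  by rewrite ltxx.
by rewrite oppr0 adde0.
Qed.

End orbit_integral.

(** * Time averages in infinite measure *)

Section infinite_ergodic_theorem.
Context {R : realType} {d : measure_display} {M : measurableType d}.
Variables (phi : R -> M -> M) (nu : {measure set M -> \bar R}).
Hypothesis hphi : is_flow phi.
Hypothesis nu_sigma_finite : sigma_finite [set: M] nu.
Hypothesis nu_infinite : nu [set: M] = +oo%E.
Hypothesis phi_preserving : measure_preserving phi nu.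
Hypothesis phi_ergodic : ergodic phi nu.
Variables (g : M -> R) (K : R).
Hypothesis gK : forall w, `|g w| <= K.
Hypothesis g0 : forall w, 0 <= g w.
Hypothesis g_integrable : nu.-integrable [set: M] (EFin \o g).

Let mg : measurable_fun [set: M] g.
Proof. by apply/measurable_EFinP; exact: measurable_int g_integrable. Qed.

Local Notation I n w := (orbit_integral phi g n%:R w).

Let ID m n w : I (m + n)%N w = I m w + I n (phi m%:R w).
Proof. by rewrite natrD (orbit_integralD hphi mg gK). Qed.

(** The superlevel set of the maximal function of the time averages,
    truncated at time N so that the stretches used in [visits_above_average]
    have bounded length. *)
Definition above_average (a : R) (N : nat) : set M :=
  [set w | exists n : nat, (0 < n <= N)%N /\ a * n%:R < I n w].

Lemma measurable_orbit_integral_gt n (c : R) :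
  measurable [set w | c < I n w].
Proof.
have := @measurable_orbit_integral _ _ _ _ hphi _ _ mg gK _ (ler0n R n).
move=> /(_ measurableT `]c, +oo[%classic (measurable_itv _)); rewrite setTI.
by congr measurable; apply/seteqP; split => w /=; rewrite in_itv/= andbT.
Qed.

Lemma measurable_above_average a N : measurable (above_average a N).
Proof.
rewrite (_ : above_average a N =
    \bigcup_(n in [set n | (0 < n <= N)%N]) [set w | a * n%:R < I n w]).
  by apply: bigcup_measurable => n _; exact: measurable_orbit_integral_gt.
by apply/seteqP; split => [w [n [? ?]]|w [n /= ? ?]]; exists n.
Qed.

(** A greedy covering of the orbit: at a visit, some stretch of at most N
    steps carries an integral larger than a times its length; jump over it
    and start again. The last stretch overruns the time m by at most N. *)
Lemma visits_above_average a N m w : 0 <= a ->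
  \sum_(k < m) a * \1_(above_average a N) (phi k%:R w) <= I (m + N)%N w.
Proof.
move=> a0; elim/ltn_ind : m w => -[_ w|m IH w].
  by rewrite big_ord0 orbit_integral_ge0.
have ind x : a * \1_(above_average a N) x <= a.
  by rewrite ler_piMr// indicE lern1 leq_b1.
have [[n [/andP[n0 nN] anI]]|wE] := pselect (above_average a N w); last first.
  rewrite big_ord_recl (flow0 hphi) indicE memNset// mulr0 add0r.
  under eq_bigr do rewrite lift0 -addn1 natrD (flowD hphi).
  apply: le_trans (IH m (ltnSn m) _) _.
  by rewrite addSn -[(m + N).+1]add1n [leRHS]ID lerDr orbit_integral_ge0.
have anI' : a * n%:R <= I n w by exact: ltW.
have [mn|nm] := leqP m.+1 n.
  apply: (@le_trans _ _ (a * m.+1%:R)).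
    rewrite mulr_natr -[m.+1 in leRHS]card_ord -sumr_const.
    exact: ler_sum.
  apply: le_trans (le_trans _ anI') _; first by rewrite ler_wpM2l// ler_nat.
  apply: (le_orbit_integral hphi mg gK g0) => //.
  by rewrite ler_nat (leq_trans nN)// leq_addl.
rewrite -(subnKC (ltnW nm)) big_split_ord/= -addnA ID lerD//.
  apply: le_trans anI'; rewrite -[n in leRHS]card_ord mulr_natr -sumr_const.
  exact: ler_sum.
under eq_bigr do rewrite addnC natrD (flowD hphi).
by apply: IH; rewrite ltn_subrL n0.
Qed.

(** The maximal inequality, obtained by integrating the orbit count against
    nu. The choice m = N gives the constant (m + N) / m = 2. *)
Lemma measure_above_average a N : 0 <= a ->
  (a%:E * nu (above_average a N) <= 2%:E * \int[nu]_w (g w)%:E)%E.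
Proof.
move=> a0.
have [->|N0] := posnP N.
  rewrite (_ : above_average a 0 = set0).
    rewrite measure0 mule0 mule_ge0//; apply: integral_ge0 => w _.
    by rewrite lee_fin.
  rewrite -subset0 => w [n [/andP[n0]]]; rewrite leqn0 => /eqP n0'.
  by rewrite n0' in n0.
have mE := measurable_above_average a N.
have mE1 : measurable_fun [set: M] (\1_(above_average a N) : M -> R).
  exact: measurable_indic.
have mphi t : measurable_fun [set: M] (phi t).
  exact: (measurableT_comp (measurable_flow hphi) (measurable_pair1 t)).
have : (\int[nu]_w (\sum_(k < N) a * \1_(above_average a N) (phi k%:R w))%:E
    <= \int[nu]_w (I (N + N)%N w)%:E)%E.
  apply: ge0_le_integral => //.
  - move=> w _; rewrite lee_fin sumr_ge0// => k _.
    by rewrite mulr_ge0.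
  - apply/measurable_EFinP; apply: measurable_sum => k.
    apply: measurable_funM => //.
    exact: (measurableT_comp (f := \1_(above_average a N) : M -> R)).
  - apply/measurable_EFinP.
    exact: (measurable_orbit_integral hphi mg gK).
  - by move=> w _; rewrite lee_fin visits_above_average.
rewrite (integral_orbit_integral hphi mg gK g0 phi_preserving nu_sigma_finite)//.
have Ek (k : 'I_N) : (\int[nu]_w (a * \1_(above_average a N) (phi k%:R w))%:E =
    a%:E * nu (above_average a N))%E.
  rewrite (integral_preserving hphi phi_preserving k%:R
    (h := fun w => (a * (\1_(above_average a N) w))%:E)); last 2 first.
  - by apply/measurable_EFinP; exact: measurable_funM.
  - by move=> w; rewrite lee_fin mulr_ge0.
  under eq_integral do rewrite EFinM.
  rewrite ge0_integralZl//; last exact/measurable_EFinP.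
  by rewrite integral_indic// setIT.
under eq_integral do rewrite -sumEFin.
rewrite ge0_integral_sum//; last 2 first.
- move=> k; apply/measurable_EFinP; apply: measurable_funM => //.
  exact: measurableT_comp.
- by move=> k w _; rewrite lee_fin mulr_ge0.
under eq_bigr do rewrite Ek.
rewrite sumr_const card_ord natrD => NE.
rewrite -(@lee_pmul2l _ N%:R%:E)//; last by rewrite lte_fin ltr0n.
rewrite [leRHS]muleA -EFinM mulr2n mulrDr mulr1.
by apply: le_trans NE; rewrite mule_natl.
Qed.

Lemma measure_ever_above_average a : 0 < a ->
  (nu (\bigcup_N above_average a N) < +oo)%E.
Proof.
move=> a0; set C := (\int[nu]_w (g w)%:E)%E.
have Coo : (2%:E * C < +oo)%E.
  rewrite lte_mul_pinfty//; case/integrableP : g_integrable => _.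
  by apply: le_lt_trans; apply: ge0_le_integral => //;
    do ?[exact/measurable_EFinP | apply/measurable_EFinP; exact: measurableT_comp];
    move=> w _; rewrite lee_fin// ler_norm.
apply: (@le_lt_trans _ _ ((a^-1)%:E * (2%:E * C))%E); last first.
  by rewrite lte_mul_pinfty// lee_fin invr_ge0 ltW.
have : nu (above_average a N) @[N --> \oo] --> nu (\bigcup_N above_average a N).
  apply: nondecreasing_cvg_mu.
  - by move=> N; exact: measurable_above_average.
  - by apply: bigcup_measurable => N _; exact: measurable_above_average.
  - move=> m n mn; apply/subsetPset => w [k [/andP[k0 km] ak]].
    by exists k; split => //; rewrite k0 (leq_trans km).
move/cvg_lim => <-//; apply: lime_le.
  apply: ereal_nondecreasing_is_cvgn => m n mn; apply: le_measure.
  - by rewrite inE; exact: measurable_above_average.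
  - by rewrite inE; exact: measurable_above_average.
  - move=> w [k [/andP[k0 km] ak]].
    by exists k; split => //; rewrite k0 (leq_trans km).
apply: nearW => N.
have := measure_above_average N (ltW a0).
rewrite -(@lee_pmul2l _ (a^-1)%:E)//; last by rewrite lte_fin invr_gt0.
by rewrite muleA -EFinM mulVf ?gt_eqF// mul1e.
Qed.

(** A substitute for the set where the limsup of the averages I n / n
    exceeds a: it contains that set, and the averages have limsup at most a
    outside of it. A change of the integrals by a quantity bounded in n does
    not affect it, which makes it invariant under every phi r. *)
Definition unbounded_excess (a : R) : set M :=
  [set w | forall c : nat, exists n : nat, a * n%:R + c%:R < I n w].

Lemma unbounded_excess_sub a :
  unbounded_excess a `<=` \bigcup_N above_average a N.
Proof.
move=> w /(_ 0%N) [n]; rewrite addr0 => anI; exists n => //; exists n.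
split => //; rewrite leqnn andbT lt0n; apply/eqP => n0.
by move: anI; rewrite n0 mulr0 orbit_integral0 ltxx.
Qed.

Lemma measurable_unbounded_excess a : measurable (unbounded_excess a).
Proof.
rewrite (_ : unbounded_excess a =
    \bigcap_c \bigcup_n [set w | a * n%:R + c%:R < I n w]).
  apply: bigcapT_measurable => c; apply: bigcupT_measurable => n.
  exact: measurable_orbit_integral_gt.
apply/seteqP; split => [w wD c _|w wD c].
  by have [n] := wD c; exists n.
by have [n _] := wD c Logic.I; exists n.
Qed.

(** Both sides of the cocycle identity compute the integral over [0, n + r];
    the difference of the two integrals of length n is that of two integrals
    of length r. *)
Lemma orbit_integral_shift n r w : 0 <= r -> `|I n (phi r w) - I n w| <= K * r.
Proof.
move=> r0.
have := orbit_integralD hphi mg gK w r0 (ler0n R n).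
rewrite addrC (orbit_integralD hphi mg gK w (ler0n R n) r0) => E.
have -> : I n (phi r w) - I n w =
  orbit_integral phi g r (phi n%:R w) - orbit_integral phi g r w.
  by move: E; lra.
have b x : 0 <= orbit_integral phi g r x <= K * r.
  rewrite orbit_integral_ge0//=.
  exact: le_trans (ler_norm _) (normr_orbit_integral hphi mg gK _ r0).
have := b (phi n%:R w); have := b w => /andP[? ?] /andP[? ?].
rewrite ler_norml; apply/andP; split; lra.
Qed.

Lemma unbounded_excess_invariant a r :
  phi r @^-1` unbounded_excess a = unbounded_excess a.
Proof.
have step s w w' : (forall n, `|I n w - I n w'| <= s) ->
    unbounded_excess a w -> unbounded_excess a w'.
  move=> ss wD c.
  have s0 : 0 <= s by rewrite (le_trans _ (ss 0%N)).
  have [n an] := wD (c + (Num.truncn s).+1)%N; exists n.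
  have := ss n; rewrite ler_norml => /andP[_].
  have := truncnS_gt s; rewrite natrD in an; lra.
have E w : forall n, `|I n (phi r w) - I n w| <= K * `|r|.
  move=> n; have [r0|r0] := leP 0 r.
    by rewrite (ger0_norm r0) orbit_integral_shift.
  rewrite (ltr0_norm r0) distrC.
  have -> : I n w = I n (phi (- r) (phi r w)).
    by rewrite -(flowD hphi) addNr (flow0 hphi).
  by apply: orbit_integral_shift; rewrite oppr_ge0 ltW.
apply/seteqP; split => w /=; apply: (step (K * `|r|)); first exact: E.
by move=> n; rewrite distrC.
Qed.

(** An invariant set of finite measure cannot be conull when nu is infinite,
    so that it is null by ergodicity. *)
Lemma measure_unbounded_excess a : 0 < a -> nu (unbounded_excess a) = 0%E.
Proof.
move=> a0; have mD := measurable_unbounded_excess a.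
have [//|DC] := phi_ergodic mD (unbounded_excess_invariant a).
have : (nu (unbounded_excess a) < +oo)%E.
  apply: le_lt_trans (measure_ever_above_average a0).
  apply: le_measure; rewrite ?inE//; last exact: unbounded_excess_sub.
  by apply: bigcup_measurable => N _; exact: measurable_above_average.
move=> Doo; move: nu_infinite.
rewrite -(setUv (unbounded_excess a)) measureU//; last 2 first.
- exact: measurableC.
- by rewrite setICr.
by rewrite [X in (_ + X)%E]DC adde0 => E; rewrite E ltxx in Doo.
Qed.

(** Outside of the null sets of unbounded excess over 1 / j, the integrals
    satisfy I n <= n / j + c for some c depending on the point. *)
Lemma infinite_ergodic_average :
  {ae nu, forall w, n%:R^-1 * I n w @[n --> \oo] --> 0}.
Proof.
have N0 : nu.-negligible (\bigcup_j unbounded_excess j.+1%:R^-1).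
  apply: negligible_bigcup => j; apply/negligibleP.
    exact: measurable_unbounded_excess.
  by apply: measure_unbounded_excess; rewrite invr_gt0.
apply: negligibleS N0 => w /= nw.
apply: contrapT => nD; apply: nw.
apply/cvgrPdist_le => e e0.
have [j je] : exists j : nat, j.+1%:R^-1 <= e / 2.
  exists (Num.truncn (e / 2)^-1).
  rewrite invf_ple ?posrE ?divr_gt0//; exact/ltW/truncnS_gt.
have {nD} : ~ unbounded_excess j.+1%:R^-1 w by move=> D; apply: nD; exists j.
move=> /existsNP[c] /forallNP nc.
near=> n.
have n0 : 0 < n%:R :> R by rewrite ltr0n; near: n; exists 1%N.
rewrite sub0r normrN normrM ger0_norm ?invr_ge0// ger0_norm ?orbit_integral_ge0//.
rewrite ler_pdivrMl// mulrC.
have /negP := nc n; rewrite -leNgt => /le_trans; apply.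
have cn : c%:R <= e / 2 * n%:R.
  rewrite [leRHS]mulrC -ler_pdivrMr ?divr_gt0//.
  near: n; exists (Num.truncn (c%:R / (e / 2))).+1 => // n /= tn.
  by apply: le_trans (ltW (truncnS_gt _)) _; rewrite ler_nat.
have jn : j.+1%:R^-1 * n%:R <= e / 2 * n%:R by rewrite ler_wpM2r.
by apply: le_trans (lerD jn cn) _; rewrite -mulrDl -splitr mulrC.
Unshelve. all: by end_near. Qed.

End infinite_ergodic_theorem.

(** * Absolutely continuous curves *)

Section interval_induction.
Context {R : realType}.

(** Cousin's lemma: a property of intervals that is inherited by unions of
    adjacent intervals, and holds for all small intervals around each point,
    holds for the whole segment. The supremum of the t for which P a t holds
    must be b. *)
Lemma interval_induction (P : R -> R -> Prop) (a b : R) : a <= b ->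
  (forall r s t, a <= r -> r <= s -> s <= t -> t <= b ->
    P r s -> P s t -> P r t) ->
  (forall p, a <= p -> p <= b -> exists2 e : R, 0 < e &
    forall u v, a <= u -> u <= p -> p <= v -> v <= b -> v - u < e -> P u v) ->
  P a b.
Proof.
move=> ab Ptrans Ploc.
pose S := [set t | [/\ a <= t, t <= b & P a t]].
have Sa : S a.
  split=> //; have [e e0 Pe] := Ploc a (lexx a) ab.
  by apply: Pe => //; rewrite subrr.
have bS : ubound S b by move=> t [].
have hS : has_sup S by split; [exists a|exists b].
have as_ : a <= sup S by apply: sup_ubound; [exact: hS.2|].
have sb : sup S <= b by apply: sup_le_ub => //; exists a.
have [e e0 Pe] := Ploc _ as_ sb.
have e20 : 0 < e / 2 by rewrite divr_gt0.
have [t [at_ tb Pat] st] := sup_adherent e20 hS.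
have ts : t <= sup S by apply: sup_ubound => //; exact: hS.2.
pose v := Num.min b (sup S + e / 4).
have sv : sup S <= v by rewrite le_min sb/= lerDl divr_ge0// ltW.
have vb : v <= b by rewrite ge_min lexx.
have ve : v <= sup S + e / 4 by rewrite ge_min lexx orbT.
have Pav : P a v.
  apply: (Ptrans a t v) => //; first exact: le_trans sv.
  by apply: Pe => //; lra.
suff <- : v = b by [].
apply/eqP; rewrite eq_le vb/= /v le_min lexx/=.
have : v <= sup S by apply: sup_ubound; [exact: hS.2|split => //; exact: le_trans sv].
rewrite /v ge_min => /orP[bs|]; last by move: e0; lra.
by rewrite (le_trans bs)// lerDl divr_ge0// ltW.
Qed.

End interval_induction.

Section row_norm.
Context {R : realType} {n : nat}.

Lemma normr_row_le (x : 'rV[R]_n) c : 0 <= c ->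
  (forall i, `|x ord0 i| <= c) -> `|x| <= c.
Proof.
move=> c0 xc; rewrite /Num.norm/= mx_normrE; apply/bigmax_leP; split=> //.
by move=> [i j] _ /=; rewrite ord1.
Qed.

Lemma le_row_normr (x : 'rV[R]_n) i : `|x ord0 i| <= `|x|.
Proof.
by rewrite [leRHS]/Num.norm/= mx_normrE; apply: (le_bigmax _ _ (ord0, i)).
Qed.

End row_norm.

Section slope.
Context {R : realType}.

(** Differentiability as a bound on increments, without division by v - t.
    For row vectors it can be checked coordinate by coordinate. *)
Definition slope_at (V : normedModType R) (x : R -> V) (t : R) (D : V) :=
  forall e : R, 0 < e ->
    \forall v \near t, `|x v - x t - (v - t) *: D| <= e * `|v - t|.

Lemma is_derive_slope_at (V : normedModType R) (x : R -> V) t D :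
  is_derive t (1 : R) x D -> slope_at x t D.
Proof.
move=> dx e e0.
have := @ex_derive _ _ _ _ _ _ _ dx; rewrite /derivable => /cvg_ex[l xl].
have lD : l = D.
  by rewrite -(@derive_val _ _ _ _ _ _ _ dx); apply/esym/cvg_lim.
rewrite {l}lD in xl.
move/cvgrPdist_le : xl => /(_ _ e0); rewrite /dnbhs near_withinE => H.
have vt0 : v - t @[v --> t] --> (0 : R).
  by rewrite -[X in _ --> X](subrr t); apply: cvgB; [exact: cvg_id|exact: cvg_cst].
have {vt0}H := vt0 _ H; apply: (@filterS _ (nbhs t) _ _ _ _ H) => v Hv.
have [->|vt] := eqVneq v t; first by rewrite !subrr scale0r subrr !normr0 mulr0.
have vt0 : v - t != 0 by rewrite subr_eq0.
move: Hv => /= /(_ vt0); rewrite /= -[_%:A]/((v - t) * 1) mulr1 subrK => {}Hv.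
have -> : x v - x t - (v - t) *: D = - ((v - t) *: (D - (v - t)^-1 *: (x v - x t))).
  by rewrite scalerBr scalerA divff// scale1r opprB.
by rewrite normrN normrZ mulrC ler_wpM2r.
Qed.

Lemma slope_atB (V : normedModType R) (x y : R -> V) t D E :
  slope_at x t D -> slope_at y t E -> slope_at (fun s => x s - y s) t (D - E).
Proof.
move=> sx sy e e0.
have /sx hx : 0 < e / 2 by rewrite divr_gt0.
have /sy hy : 0 < e / 2 by rewrite divr_gt0.
apply: filterS2 hx hy => v hx hy.
rewrite (splitr e) mulrDl.
have -> : x v - y v - (x t - y t) - (v - t) *: (D - E) =
    (x v - x t - (v - t) *: D) - (y v - y t - (v - t) *: E).
  by rewrite scalerBr !opprD !opprK (addrACA (x v)) (addrACA (x v - x t)).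
apply: le_trans (ler_normB _ _) _; exact: lerD.
Qed.

Lemma slope_at_mx n (x : R -> 'rV[R]_n) t (D : 'rV[R]_n) :
  (forall i, slope_at (fun s => x s ord0 i : R) t (D ord0 i : R)) ->
  slope_at x t D.
Proof.
move=> h e e0.
have := filter_forall (nbhs_filter t) (fun i => h i e e0).
apply: filterS => v hv.
apply: normr_row_le; first by rewrite mulr_ge0// ltW.
by move=> i; rewrite !mxE; exact: hv.
Qed.

End slope.

Section absolute_continuity.
Context {R : realType} {n : nat}.
Local Notation leb := (@lebesgue_measure R).
Implicit Types x y : R -> 'rV[R]_n.

Lemma lipschitz_absolutely_continuous a b (K : R) x :
  (forall u v, a <= u -> u <= v -> v <= b -> `|x v - x u| <= K * (v - u)) ->
  absolutely_continuous a b x.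
Proof.
move=> xK e e0; have K0 : 0 < `|K| + 1 by rewrite ltr_wpDl.
exists (e / (`|K| + 1)); first by rewrite divr_gt0.
move=> N u v uv _; rewrite ltr_pdivlMr// mulrC; apply: le_lt_trans.
rewrite mulr_sumr; apply: ler_sum => i _; have [au uvi vb] := uv i.
apply: le_trans (xK _ _ au uvi vb) _; rewrite ler_wpM2r ?subr_ge0//.
by rewrite (le_trans (ler_norm _))// lerDl.
Qed.

Lemma absolutely_continuousB a b x y : absolutely_continuous a b x ->
  absolutely_continuous a b y -> absolutely_continuous a b (fun t => x t - y t).
Proof.
move=> ax ay e e0; have e2 : 0 < e / 2 by rewrite divr_gt0.
have [d1 d10 h1] := ax _ e2; have [d2 d20 h2] := ay _ e2.
exists (Num.min d1 d2); first by rewrite lt_min d10.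
move=> N u v uv tI; rewrite lt_min => /andP[s1 s2].
apply: le_lt_trans (_ : \sum_i (`|x (v i) - x (u i)| + `|y (v i) - y (u i)|) < e).
  apply: ler_sum => i _; rewrite (_ : _ - _ = (x (v i) - x (u i)) - (y (v i) - y (u i))).
    exact: ler_normB.
  by rewrite !opprD opprK (addrACA (x _)).
by rewrite big_split/= (splitr e) ltrD// ?h1 ?h2.
Qed.

Lemma absolutely_continuousS a b a' b' x : a <= a' -> b' <= b ->
  absolutely_continuous a b x -> absolutely_continuous a' b' x.
Proof.
move=> aa bb ax e e0; have [d d0 h] := ax _ e0; exists d => // N u v uv.
by apply: h => i; have [? ? ?] := uv i; split => //; [exact: le_trans aa _|exact: le_trans bb].
Qed.

(** The exceptional null set, with a and b added, has an open neighbourhood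
    U of small measure. A short interval around an exceptional point lies in
    U, and by absolute continuity such intervals contribute at most e / 2
    altogether; around any other point the derivatives compare the
    increments, up to a small multiple eta of the length. The two kinds of
    intervals are assembled by interval induction. *)
Lemma absolutely_continuous_comparison a b (c : R) x (Lam : R -> R) :
  a <= b -> 0 <= c -> absolutely_continuous a b x ->
  (forall u v, a <= u -> u <= v -> v <= b -> Lam u <= Lam v) ->
  {ae leb, forall t, a < t -> t < b -> exists D l,
    [/\ slope_at x t D, slope_at (Lam : R -> R) t l & `|D| <= c * l]} ->
  `|x b - x a| <= c * (Lam b - Lam a).
Proof.
move=> ab c0 xac Lam_nd [N [mN N0 badN]].
apply/ler_addgt0Pr => e e0.
(* The errors committed at the points of differentiability add up to (c +
   1) * eta * (b - a), which is less than e / 2. *)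
pose eta := e / 2 / ((c + 1) * (b - a + 1)).
have ba1 : 0 < b - a + 1 by rewrite ltr_wpDl// subr_ge0.
have c1 : 0 < c + 1 by rewrite ltr_wpDl.
have eta0 : 0 < eta by rewrite /eta !divr_gt0// mulr_gt0.
have e20 : 0 < e / 2 by rewrite divr_gt0.
have [del del0 xdel] := xac _ e20.
pose N' := N `|` [set a] `|` [set b].
have mN' : measurable N'.
  apply: measurableU; last exact: measurable_set1.
  by apply: measurableU => //; exact: measurable_set1.
have N'0 : leb N' = 0%E.
  apply/negligibleP => //; apply: negligibleU; last first.
    by apply/negligibleP; [exact: measurable_set1|exact: lebesgue_measure_set1].
  apply: negligibleU; first exact/negligibleP.
  by apply/negligibleP; [exact: measurable_set1|exact: lebesgue_measure_set1].
have [U [oU N'U UN']] : exists U : set R,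
    [/\ open U, N' `<=` U & (leb (U `\` N') < del%:E)%E].
  have N'oo : (leb N' < +oo)%E by rewrite N'0.
  have [U [oU NU UN]] := lebesgue_regularity_outer mN' N'oo del0.
  by exists U.
have mU : measurable U by exact: open_measurable.
have Udel : (leb U < del%:E)%E.
  rewrite -(setDUK N'U) measureU//; last 2 first.
  - exact: measurableD.
  - exact: setDIK.
  by rewrite [X in (X + _)%E]N'0 add0e.
(* The list l collects the intervals around exceptional points. Their total
   length is bounded by the measure of the part of U in ]s, t], which is
   additive, and this is what makes P inherited by unions. *)
pose P s t := exists l : seq (R * R),
  [/\ all (fun p => (s <= p.1) && (p.1 <= p.2) && (p.2 <= t)) l,
      pairwise (fun p q => p.2 <= q.1) l,
      ((\sum_(p <- l) (p.2 - p.1))%:E <= leb (U `&` `]s, t]))%E &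
      `|x t - x s| <= c * (Lam t - Lam s) + (c + 1) * eta * (t - s)
         + \sum_(p <- l) `|x p.2 - x p.1|].
suff [l [lab lpair lU lx]] : P a b.
  apply: le_trans lx _; rewrite -addrA lerD2l.
  rewrite (splitr e) lerD//.
    have -> : (c + 1) * eta * (b - a) = e / 2 * ((b - a) / (b - a + 1)).
      by rewrite /eta; field; rewrite !gt_eqF.
    by rewrite ler_piMr ?(ltW e20)// ler_pdivrMr// mul1r lerDl ler01.
  rewrite big_tnth; apply/ltW/xdel.
  - move=> i; have /(allP lab) : tnth (in_tuple l) i \in l by exact: mem_tnth.
    by move=> /andP[/andP[]].
  - apply/trivIsetP => i j _ _; wlog ij : i j / (i < j)%N => [WH ij|_].
      move: (ij); rewrite -val_eqE neq_ltn => /orP[|] ?; first exact: WH.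
      by rewrite setIC; apply: WH => //; rewrite eq_sym.
    have : (tnth (in_tuple l) i).2 <= (tnth (in_tuple l) j).1.
      have /(pairwiseP (0, 0)) := lpair.
      rewrite !(tnth_nth (0, 0))/=; apply=> //; exact: ltn_ord.
    move=> ij'; rewrite -subset0 => z [] /=; rewrite !in_itv/=.
    move=> /andP[_ zi] /andP[jz _].
    by have := lt_trans (lt_le_trans zi ij') jz; rewrite ltxx.
  - rewrite -lte_fin; apply: le_lt_trans Udel.
    rewrite -(big_tnth _ _ l xpredT (fun p => p.2 - p.1)).
    apply: le_trans lU _; apply: le_measure; rewrite ?inE//.
    exact: measurableI.
apply: interval_induction => //.
  move=> r s t ar rs st tb [l [la lp lU lx]] [m [ma mp mU' mx]].
  exists (l ++ m); split.
  - rewrite all_cat; apply/andP; split.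
      by apply: sub_all la => p /andP[/andP[-> ->] ps]; exact: le_trans ps st.
    by apply: sub_all ma => p /andP[/andP[sp -> ->]]; rewrite (le_trans rs).
  - rewrite pairwise_cat lp mp !andbT; apply/allrelP => p q pl qm.
    have /= /andP[/andP[_ _] ps] := allP la _ pl.
    by have /= /andP[/andP[sq _] _] := allP ma _ qm; exact: le_trans sq.
  - rewrite big_cat/= EFinD (_ : U `&` `]r, t] =
        (U `&` `]r, s]) `|` (U `&` `]s, t])); last first.
      by rewrite -setIUr -itv_bndbnd_setU.
    rewrite measureU; [exact: leeD|exact: measurableI|exact: measurableI|].
    rewrite -subset0 => z [[_ /=] + [_ /=]].
    by rewrite !in_itv/= => /andP[_ zs] /andP[sz _]; rewrite leNgt sz in zs.
  - rewrite big_cat/=; apply: le_trans (ler_distD (x s) _ _) _.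
    by apply: le_trans (lerD mx lx) _; lra.
move=> p ap pb.
have [Np|Np] := pselect (N' p).
  have : nbhs p U by apply: open_nbhs_nbhs; split => //; exact: N'U.
  rewrite nbhs_ballP => -[r /= r0 pU]; exists r => // u v au up pv vb uvr.
  have uvU : `]u, v] `<=` U.
    move=> z /=; rewrite in_itv/= => /andP[uz zv]; apply: pU.
    by rewrite /ball/= ltr_norml; apply/andP; split; lra.
  exists [:: (u, v)]; split => //=.
  - by rewrite !lexx (le_trans up).
  - rewrite big_seq1 setIidr// lebesgue_measure_itv/= lte_fin.
    have [uv|vu] := ltP u v; first by rewrite -EFinB.
    by rewrite lee_fin subr_le0.
  - rewrite big_seq1/= -[leLHS]add0r lerD// addr_ge0//.
      by rewrite mulr_ge0// subr_ge0 Lam_nd// (le_trans up).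
    by rewrite mulr_ge0 ?subr_ge0 ?(le_trans up)// mulr_ge0 ?(ltW c1) ?(ltW eta0).
have pN : ~ N p by move=> ?; apply: Np; left; left.
have {}ap : a < p.
  by rewrite lt_neqAle ap andbT; apply/eqP => E; apply: Np; left; right.
have {}pb : p < b.
  by rewrite lt_neqAle pb andbT; apply/eqP => E; apply: Np; right.
have [D [l [sx sL Dl]]] : exists D l,
    [/\ slope_at x p D, slope_at (Lam : R -> R) p l & `|D| <= c * l].
  by apply: contrapT => H; apply: pN; apply: badN => /= /(_ ap pb).
have := filterI (sx _ eta0) (sL _ eta0).
rewrite nbhs_ballP => -[r /= r0 pr].
exists r => // u v au up pv vb uvr.
have [|xv Lv] := pr v; first by rewrite /ball/= ltr_norml; apply/andP; split; lra.
have [|xu Lu] := pr u; first by rewrite /ball/= ltr_norml; apply/andP; split; lra.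
have step s : `|x s - x p - (s - p) *: D| <= eta * `|s - p| ->
    `|x s - x p| <= `|s - p| * `|D| + eta * `|s - p|.
  move=> h; rewrite -(subrK ((s - p) *: D) (x s - x p)).
  by rewrite (le_trans (ler_normD _ _))// addrC normrZ lerD2l.
exists [::]; split => //=; first by rewrite big_nil.
rewrite big_nil addr0.
have {xv}xv := step _ xv; have {step xu}xu := step _ xu.
apply: le_trans (ler_distD (x p) _ _) _; rewrite [X in _ + X]distrC.
apply: le_trans (lerD xv xu) _.
have vp0 : 0 <= v - p by rewrite subr_ge0.
have up0 : u - p <= 0 by rewrite subr_le0.
rewrite (ger0_norm vp0) (ler0_norm up0).
move: Lv Lu; rewrite (ger0_norm vp0) (ler0_norm up0) => Lv Lu.
have {}Lv : (v - p) * l - eta * (v - p) <= Lam v - Lam p.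
  by move: Lv; rewrite ler_norml /GRing.scale/= => /andP[+ _]; lra.
have {}Lu : (p - u) * l - eta * (p - u) <= Lam p - Lam u.
  by move: Lu; rewrite ler_norml /GRing.scale/= => /andP[_]; lra.
have cL := ler_wpM2l c0 (lerD Lv Lu).
have uD : (v - u) * `|D| <= (v - u) * (c * l).
  by rewrite ler_wpM2l// subr_ge0 (le_trans up).
lra.
Qed.

End absolute_continuity.

(** * Comparison of a solution with an integral *)

Section row_integral.
Context {R : realType} {n : nat}.
Local Notation leb := (@lebesgue_measure R).
Implicit Types (G : R -> 'rV[R]_n) (h : R -> R).

(** Lebesgue's differentiation theorem. *)
Lemma ae_slope_at_Rintegral h K : measurable_fun [set: R] h ->
  (forall x, `|h x| <= K) ->
  {ae leb, forall t, 0 < t ->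
    slope_at (fun u => \int[leb]_(s in `[0, u]) h s : R) t (h t : R)}.
Proof.
move=> mh hK.
have inth y : leb.-integrable [set` Interval (BLeft 0) (BRight y)] (EFin \o h).
  exact: (bounded_integrable_itv _ _ mh hK).
have loch : locally_integrable [set: R] h.
  split=> //; first exact: openT.
  move=> C _ cC.
  have mC : measurable C by exact: compact_measurable.
  have : leb.-integrable C (EFin \o h).
    apply: measurable_bounded_integrable => //.
    - exact: compact_finite_measure.
    - exact: measurable_funTS.
    - exists K; split; first by rewrite num_real.
      by move=> y Ky x _ /=; rewrite (le_trans (hK x))// ltW.
  by move=> /integrableP[].
have := FTC1 inth loch.
apply: filterS; first exact: (ae_filter_ringOfSetsType leb).
move=> t Ht t0; apply: is_derive_slope_at.
have [dt <-] := Ht t0.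
by rewrite derive1E; exact/derivableP.
Qed.

Lemma vintegral_split G K a b c : a <= b -> b <= c ->
  (forall i, measurable_fun [set: R] (fun s => G s ord0 i)) ->
  (forall s, `|G s| <= K) ->
  vintegral leb `[a, c] G = vintegral leb `[a, b] G + vintegral leb `[b, c] G.
Proof.
move=> ab bc mG GK; apply/rowP => i; rewrite !mxE.
apply: (Rintegral_itv_split (K := K)) => // s.
exact: le_trans (le_row_normr _ _) (GK s).
Qed.

Lemma normr_vintegral G K a b : a <= b ->
  (forall i, measurable_fun [set: R] (fun s => G s ord0 i)) ->
  (forall s, `|G s| <= K) ->
  `|vintegral leb `[a, b] G| <= K * (b - a).
Proof.
move=> ab mG GK; apply: normr_row_le => [|i].
  by rewrite mulr_ge0 ?subr_ge0// (le_trans _ (GK 0)).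
rewrite mxE; apply: normr_Rintegral_itv => // s.
exact: le_trans (le_row_normr _ _) (GK s).
Qed.

(** The curve X - \int_0^t G is absolutely continuous with derivative F t (X
    t) - G t at almost every t. The field G is 0 when the speed of X is to
    be bounded, the field frozen at x0 in the averaging estimate, and the
    field frozen at the current point in an Euler step. *)
Lemma ode_solution_compare (F : R -> 'rV[R]_n -> 'rV[R]_n) x0
    (X G : R -> 'rV[R]_n) (h : R -> R) (K H a b : R) :
  ode_solution F x0 X ->
  (forall i, measurable_fun [set: R] (fun s => G s ord0 i)) ->
  (forall s, `|G s| <= K) ->
  measurable_fun [set: R] h -> (forall s, 0 <= h s <= H) ->
  0 <= a -> a <= b ->
  (forall t, a < t -> t < b -> `|F t (X t) - G t| <= h t) ->
  `|X b - X a - vintegral leb `[a, b] G| <= \int[leb]_(s in `[a, b]) h s.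
Proof.
move=> [X0 Xac Xder] mG GK mh hH a0 ab FG.
have hH' s : `|h s| <= H by have /andP[? ?] := hH s; rewrite ger0_norm.
have b0 : 0 <= b by exact: le_trans ab.
pose W t := vintegral leb `[0, t] G.
pose Lam t := \int[leb]_(s in `[0, t]) h s.
have GW u v : 0 <= u -> u <= v -> W v - W u = vintegral leb `[u, v] G.
  by move=> u0 uv; rewrite /W (vintegral_split u0 uv mG GK) addrC addKr.
have GL u v : 0 <= u -> u <= v -> Lam v - Lam u = \int[leb]_(s in `[u, v]) h s.
  by move=> u0 uv; rewrite /Lam (Rintegral_itv_split u0 uv mh hH') addrC addKr.
have E : X b - X a - vintegral leb `[a, b] G = (X b - W b) - (X a - W a).
  by rewrite -(GW _ _ a0 ab) !opprD !opprK (addrACA (X b)).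
rewrite E -(GL _ _ a0 ab) -[leRHS]mul1r.
apply: (absolutely_continuous_comparison (x := fun t => X t - W t)) => //.
- apply: absolutely_continuousB.
    have b1 : 0 < b + 1 by rewrite ltr_wpDl.
    by apply: absolutely_continuousS (Xac _ b1) => //; rewrite lerDl.
  apply: (@lipschitz_absolutely_continuous _ _ _ _ K) => u v au uv vb.
  by rewrite (GW _ _ (le_trans a0 au) uv); exact: normr_vintegral.
- move=> u v au uv vb; rewrite -subr_ge0 (GL _ _ (le_trans a0 au) uv).
  by apply: Rintegral_ge0 => s _; have /andP[] := hH s.
have Faef := ae_filter_ringOfSetsType leb.
have aeW : {ae leb, forall t, forall i : 'I_n, 0 < t ->
    slope_at (fun u => \int[leb]_(s in `[0, u]) (G s ord0 i) : R) t (G t ord0 i : R)}.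
  have := filter_forall Faef (fun i => ae_slope_at_Rintegral (mG i)
    (fun s => le_trans (le_row_normr _ _) (GK s))).
  exact.
have aeL := ae_slope_at_Rintegral mh hH'.
apply: (filterS3 _ _ aeW aeL Xder) => t Wt Lt Xt at_ tb.
have t0 : 0 < t by exact: le_lt_trans at_.
exists (F t (X t) - G t), (h t); split.
- apply: slope_atB; first by apply: is_derive_slope_at; exact: Xt.
  apply: slope_at_mx => i.
  rewrite (_ : (fun s => _) = (fun u => \int[leb]_(s in `[0, u]) (G s ord0 i))).
    exact: Wt.
  by apply/funext => s; rewrite /W mxE.
- exact: Lt.
- by rewrite mul1r; exact: FG.
Qed.

End row_integral.

(** * The averaging estimate *)

Section lipschitz_constant.
Context {R : realType} {V W : normedModType R}.
Variables (g : V -> W) (K : R).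
Hypothesis gK : forall x y, `|g x - g y| <= K * `|x - y|.

Let quotients := [set r | exists x y, x != y /\ r = `|g x - g y| / `|x - y|].

Let quotients_le : ubound quotients K.
Proof.
move=> _ [x [y [xy ->]]].
by rewrite ler_pdivrMr ?normr_gt0 ?subr_eq0.
Qed.

Lemma lipschitz_constant_ge0 : 0 <= lipschitz_constant g.
Proof.
rewrite /lipschitz_constant -/quotients.
(* V may have a single point; there are then no difference quotients, and
   sup0 makes the constant 0. *)
have [->|/set0P[r qr]] := eqVneq quotients set0; first by rewrite sup0.
apply: (@le_trans _ _ r); first by move: qr => [x [y [_ ->]]].
by apply: sup_ubound => //; exists K.
Qed.

Lemma lipschitz_constant_le : 0 <= K -> lipschitz_constant g <= K.
Proof.
move=> K0; rewrite /lipschitz_constant -/quotients.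
have [->|/set0P q0] := eqVneq quotients set0; first by rewrite sup0.
exact: sup_le_ub.
Qed.

Lemma lipschitz_constantP x y : `|g x - g y| <= lipschitz_constant g * `|x - y|.
Proof.
have [->|xy] := eqVneq x y; first by rewrite !subrr !normr0 mulr0.
rewrite -ler_pdivrMr ?normr_gt0 ?subr_eq0//.
by apply: sup_ubound; [exists K|exists x, y].
Qed.

End lipschitz_constant.

Section averaging.
Context {R : realType} {n : nat} {d : measure_display} {M : measurableType d}.
Local Notation leb := (@lebesgue_measure R).
Variable phi : R -> M -> M.
Hypothesis hphi : is_flow phi.

Lemma measurable_along_scaled_orbit (g : M -> R) e w :
  measurable_fun [set: M] g ->
  measurable_fun [set: R] (fun s => g (phi (s / e) w)).
Proof.
move=> mg; apply: (measurableT_comp (measurable_along_orbit hphi w mg)).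
exact: mulrr_measurable.
Qed.

Lemma scaled_orbit_integral (g : M -> R) K e t w : 0 < e ->
  measurable_fun [set: M] g -> (forall w, `|g w| <= K) ->
  \int[leb]_(s in `[0, t]) g (phi (s / e) w) = e * orbit_integral phi g (t / e) w.
Proof.
move=> e0 mg gK.
have := @Rintegral_affine _ (fun s => g (phi (s / e) w)) K 0 (t / e) e 0 e0
  (measurable_along_scaled_orbit _ _ mg) (fun x => gK _).
rewrite mulr0 !addr0 mulrCA divff ?gt_eqF// mulr1 => ->.
congr (_ * _); apply: eq_Rintegral => s _.
by rewrite addr0 mulrAC divff ?gt_eqF// mul1r.
Qed.

Variables (f : 'rV[R]_n -> M -> 'rV[R]_n) (x0 : 'rV[R]_n) (Kb Kl : R).
Hypothesis f_measurable_coord :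
  forall x i, measurable_fun [set: M] (fun w => f x w ord0 i).
Hypothesis f_bounded : forall x w, `|f x w| <= Kb.
Hypothesis f_lipschitz : forall w x y, `|f x w - f y w| <= Kl * `|x - y|.
Hypothesis Kl0 : 0 <= Kl.
Hypothesis lip_measurable :
  measurable_fun [set: M] (fun w => lipschitz_constant (f ^~ w)).
Variables (X : R -> R -> M -> 'rV[R]_n).
Hypothesis X_solution : forall e w, 0 < e ->
  ode_solution (fun t x => f x (phi (t / e) w)) x0 (fun t => X e t w).

Local Notation L := (fun w => lipschitz_constant (f ^~ w)).

(** The displacement along the field frozen at x0, which approximates X e t
    w - x0. *)
Definition averaged (e t : R) (w : M) : 'rV[R]_n :=
  vintegral leb `[0, t] (fun s => f x0 (phi (s / e) w)).

(** The relative size of the averaging error: e times the integral of the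
    Lipschitz constant along the orbit up to time t / e. *)
Definition lip_mass (e t : R) (w : M) : R :=
  \int[leb]_(s in `[0, t]) L (phi (s / e) w).

Let L0 w : 0 <= L w.
Proof. exact: lipschitz_constant_ge0 (f_lipschitz w). Qed.

Let LK w : `|L w| <= Kl.
Proof. by rewrite ger0_norm// (lipschitz_constant_le (f_lipschitz w)). Qed.

Let mG e w i : measurable_fun [set: R] (fun s => f x0 (phi (s / e) w) ord0 i).
Proof. exact: (measurable_along_scaled_orbit e w (f_measurable_coord x0 i)). Qed.

Let Kb0 (w : M) : 0 <= Kb. Proof. exact: le_trans (f_bounded x0 w). Qed.

Lemma lip_massE e t w : 0 < e ->
  lip_mass e t w = e * orbit_integral phi L (t / e) w.
Proof. by move=> e0; exact: (scaled_orbit_integral t w e0 lip_measurable LK). Qed.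

Lemma averagedE e t w : 0 < e -> averaged e t w =
  e *: vintegral leb `[0, t / e] (fun s => f x0 (phi s w)).
Proof.
move=> e0; apply/rowP => i; rewrite !mxE.
apply: (scaled_orbit_integral (K := Kb) t w e0 (f_measurable_coord x0 i)) => w'.
exact: le_trans (le_row_normr _ _) (f_bounded _ _).
Qed.

Lemma normr_averaged e t w : 0 <= t -> `|averaged e t w| <= Kb * t.
Proof.
by move=> t0; rewrite -[t in leRHS]subr0; apply: normr_vintegral => //; exact: mG.
Qed.

Lemma solution_displacement e s t w : 0 < e -> 0 <= s -> s <= t ->
  `|X e t w - X e s w| <= Kb * (t - s).
Proof.
move=> e0 s0 st.
have -> : X e t w - X e s w = X e t w - X e s w - vintegral leb `[s, t] (fun=> 0).
  rewrite (_ : vintegral _ _ _ = 0) ?subr0//.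
  by apply/rowP => i; rewrite !mxE Rintegral_cst// mul0r.
apply: le_trans (ode_solution_compare (X_solution w e0) (G := fun=> 0)
  (h := fun=> Kb) (K := 0) (H := Kb) _ _ _ _ _ _ _) _ => //.
- by move=> ?; rewrite normr0.
- by move=> ?; rewrite lexx (Kb0 w).
- by move=> u _ _; rewrite subr0.
rewrite Rintegral_cst//= lebesgue_measure_itv/= lte_fin.
by move: st; rewrite le_eqVlt => /predU1P[->|->//]; rewrite ltxx subrr.
Qed.

(** Let m be the supremum of the error over [0, T]. At time s the derivative
    of the error is at most L (phi (s / e) w) * |X s - x0|, hence at most L
    (phi (s / e) w) * (m + S), so that m <= lip_mass * (m + S), and the term
    in m is absorbed since lip_mass <= 1 / 2. *)
Lemma averaging_error e T S w : 0 < e -> 0 <= T -> lip_mass e T w <= 2^-1 ->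
  (forall t, 0 <= t <= T -> `|averaged e t w| <= S) ->
  forall t, 0 <= t <= T ->
  `|X e t w - x0 - averaged e t w| <= 2 * lip_mass e T w * S.
Proof.
move=> e0 T0 dle WS.
have S0 : 0 <= S by rewrite (le_trans _ (WS 0 _))// lexx.
have [X0 _ _] := X_solution w e0.
pose E t := `|X e t w - x0 - averaged e t w|.
pose m := sup [set E t | t in `[0, T]].
have Em t : 0 <= t <= T -> E t <= m.
  move=> tT; apply: sup_ubound; last by exists t.
  exists (Kb * T + Kb * T) => y [s /=]; rewrite in_itv/= => /andP[s0 sT] <-.
  rewrite (le_trans (ler_normB _ _))// lerD//.
    rewrite -X0 (le_trans (solution_displacement w e0 (lexx 0) s0))// subr0.
    by rewrite ler_wpM2l// (Kb0 w).
  by rewrite (le_trans (normr_averaged _ _ s0))// ler_wpM2l// (Kb0 w).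
have d0 : 0 <= lip_mass e T w by apply: Rintegral_ge0 => s _; exact: L0.
have m0 : 0 <= m by apply: le_trans (normr_ge0 _) (Em 0 _); rewrite lexx.
have mL : measurable_fun [set: R] (fun s => L (phi (s / e) w)).
  exact: (measurable_along_scaled_orbit e w lip_measurable).
have intL t : leb.-integrable `[0, t] (EFin \o (fun s => L (phi (s / e) w))).
  by apply: (bounded_integrable_itv _ _ mL) => s; exact: LK.
have EM t : 0 <= t <= T -> E t <= (m + S) * lip_mass e T w.
  move=> /andP[t0 tT]; rewrite /E -[in leLHS]X0.
  apply: le_trans (ode_solution_compare (X_solution w e0) (K := Kb)
    (G := fun s => f x0 (phi (s / e) w)) (h := fun s => (m + S) * L (phi (s / e) w))
    (H := (m + S) * Kl) _ _ _ _ _ _ _) _ => //.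
  - exact: measurable_funM.
  - move=> s; rewrite mulr_ge0 ?addr_ge0//= ler_wpM2l ?addr_ge0//.
    by rewrite (le_trans (ler_norm _)) ?LK.
  - move=> s s0 st; rewrite (le_trans (lipschitz_constantP (f_lipschitz _) _ _))//.
    rewrite mulrC ler_wpM2r//.
    have sT : 0 <= s <= T by rewrite (ltW s0)/= (le_trans (ltW st)).
    rewrite -(subrK (averaged e s w) (X e s w - x0)) (le_trans (ler_normD _ _))//.
    by rewrite lerD ?WS//; exact: Em.
  rewrite RintegralZl// ler_wpM2l ?addr_ge0//.
  rewrite /lip_mass (Rintegral_itv_split (K := Kl) t0 tT mL)//.
  by rewrite lerDl; apply: Rintegral_ge0 => s _; exact: L0.
have mle : m <= (m + S) * lip_mass e T w.
  apply: sup_le_ub; first by exists (E 0), 0 => //=; rewrite in_itv/= lexx.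
  by move=> y [t /=]; rewrite in_itv/= => tT <-; exact: EM.
have mh : m * lip_mass e T w <= m * 2^-1 by rewrite ler_wpM2l.
by move=> t tT; apply: le_trans (Em _ tT) _; lra.
Qed.

Variable nu : {measure set M -> \bar R}.
Hypothesis nu_sigma_finite : sigma_finite [set: M] nu.
Hypothesis nu_infinite : nu [set: M] = +oo%E.
Hypothesis phi_preserving : measure_preserving phi nu.
Hypothesis phi_ergodic : ergodic phi nu.
Hypothesis f_lipschitz_integrable :
  nu.-integrable [set: M] (fun w => (lipschitz_constant (f ^~ w))%:E).

(** Time averages over integer times: they form a sequence, to which the
    ergodic theorem and the dominated convergence theorem apply. *)
Definition mean_lip (N : nat) (w : M) : R :=
  N%:R^-1 * orbit_integral phi L N%:R w.

Definition time_index (T e : R) : nat := (Num.truncn (T / e)).+1.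

Lemma time_index_cvg T : 0 < T -> time_index T e @[e --> 0^'+] --> \oo.
Proof.
move=> T0 A [m _ mA].
suff : \forall e \near (0 : R)^'+, (m <= time_index T e)%N.
  by apply: filterS => e; exact: mA.
near=> e; have e0 : 0 < e by near: e; exact: nbhs_right_gt.
rewrite /time_index ltnW// ltnS truncn_ge_nat ?divr_ge0 ?(ltW T0) ?(ltW e0)//.
rewrite ler_pdivlMr//.
have : e <= T / m.+1%:R by near: e; apply: nbhs_right_le; rewrite divr_gt0.
rewrite ler_pdivlMr// mulrC; apply: le_trans.
by rewrite ler_wpM2r ?(ltW e0)// ler_nat.
Unshelve. all: by end_near. Qed.

Lemma lip_mass_ge0 e T w : 0 <= lip_mass e T w.
Proof. by apply: Rintegral_ge0 => s _; exact: L0. Qed.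

(** As time_index T e is larger than T / e by at most 1, e times it is at
    most T + e. *)
Lemma lip_mass_le_mean e T w : 0 < e -> 0 <= T ->
  lip_mass e T w <= (T + e) * mean_lip (time_index T e) w.
Proof.
move=> e0 T0; rewrite lip_massE// /mean_lip.
set N := time_index T e.
have N0 : 0 < N%:R :> R by rewrite ltr0n.
have TN : T / e <= N%:R by exact/ltW/truncnS_gt.
have I0 : 0 <= orbit_integral phi L N%:R w by exact: orbit_integral_ge0.
apply: (@le_trans _ _ (e * orbit_integral phi L N%:R w)).
  rewrite ler_wpM2l ?(ltW e0)//.
  by apply: (le_orbit_integral hphi lip_measurable LK L0); rewrite ?divr_ge0// ltW.
rewrite mulrA ler_wpM2r// ler_pdivlMr//.
have : N%:R <= T / e + 1.
  rewrite /N /time_index -addn1 natrD lerD2r.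
  by have /andP[] := truncn_itv (divr_ge0 T0 (ltW e0)).
rewrite -(ler_pM2l e0) mulrDr mulr1 mulrCA divff ?gt_eqF// mulr1.
by [].
Qed.

Lemma lip_mass_cvg0 :
  {ae nu, forall w, forall T, 0 < T -> lip_mass e T w @[e --> 0^'+] --> 0}.
Proof.
have := infinite_ergodic_average hphi nu_sigma_finite nu_infinite phi_preserving
  phi_ergodic LK L0 f_lipschitz_integrable.
apply: filterS => w Hw T T0.
have H : (T + 1) * mean_lip (time_index T e) w @[e --> 0^'+] --> 0.
  rewrite -[X in _ --> X](mulr0 (T + 1)); apply: cvgMr.
  exact: cvg_comp (time_index_cvg T0) Hw.
apply: squeeze_cvgr (cvg_cst 0) H; near=> e.
have e0 : 0 < e by near: e; exact: nbhs_right_gt.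
rewrite lip_mass_ge0/=; apply: le_trans (lip_mass_le_mean w e0 (ltW T0)) _.
rewrite ler_wpM2r ?lerD2l//; last by near: e; exact: nbhs_right_le.
by rewrite mulr_ge0 ?invr_ge0// orbit_integral_ge0.
Unshelve. all: by end_near. Qed.

(** By averaging_error, the ratio of the two suprema is at most 2 *
    lip_mass, which tends to 0. *)
Lemma averaging_sup_littleo T : 0 < T -> {ae nu, forall w,
  (fun e : R => sup [set `|X e t w - x0 - averaged e t w| | t in `[0, T]])
  =o_ (0^'+)
  (fun e : R => sup [set `|averaged e t w| | t in `[0, T]])}.
Proof.
move=> T0; apply: filterS lip_mass_cvg0 => w /(_ _ T0) dw.
apply/eqoP => c c0 /=.
have hw : \forall e \near 0^'+, lip_mass e T w <= Num.min 2^-1 (c / 2).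
  move/cvgrPdist_le : dw => /(_ (Num.min 2^-1 (c / 2))).
  rewrite lt_min invr_gt0 ltr0n divr_gt0// => /(_ isT).
  apply: filterS => e; rewrite sub0r normrN; exact: le_trans (ler_norm _).
near=> e.
have e0 : 0 < e by near: e; exact: nbhs_right_gt.
have : lip_mass e T w <= Num.min 2^-1 (c / 2) by near: e; exact: hw.
rewrite le_min => /andP[d2 dc].
set S := sup [set `|averaged e t w| | t in `[0, T]].
have WS t : 0 <= t <= T -> `|averaged e t w| <= S.
  move=> tT; apply: sup_ubound; last by exists t.
  exists (Kb * T) => y [s /=]; rewrite in_itv/= => /andP[s0 sT] <-.
  by rewrite (le_trans (normr_averaged _ _ s0))// ler_wpM2l// (Kb0 w).
have S0 : 0 <= S by apply: le_trans (normr_ge0 _) (WS 0 _); rewrite lexx ltW.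
have err := averaging_error e0 (ltW T0) d2 WS.
rewrite (ger0_norm S0) ger0_norm.
  apply: sup_le_ub.
    by exists `|X e 0 w - x0 - averaged e 0 w|, 0 => //=; rewrite in_itv/= lexx ltW.
  move=> y [t /=]; rewrite in_itv/= => tT <-; apply: le_trans (err _ tT) _.
  by rewrite ler_wpM2r//; lra.
have h0 : (0 : R) <= 0 <= T by rewrite lexx (ltW T0).
apply: le_trans (normr_ge0 (X e 0 w - x0 - averaged e 0 w)) _.
apply: sup_ubound; last by exists 0.
by exists (2 * lip_mass e T w * S) => y [t /=]; rewrite in_itv/= => tT <-; exact: err.
Unshelve. all: by end_near. Qed.

Lemma measurable_lip_mass e T : 0 < e -> 0 <= T ->
  measurable_fun [set: M] (lip_mass e T).
Proof.
move=> e0 T0; rewrite (_ : lip_mass e T = fun w => e * orbit_integral phi L (T / e) w).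
  apply: measurable_funM => //.
  by apply: (measurable_orbit_integral hphi lip_measurable LK); rewrite divr_ge0// ltW.
by apply/funext => w; exact: lip_massE.
Qed.

Lemma lip_mass_le e T w : 0 <= T -> lip_mass e T w <= Kl * T.
Proof.
move=> T0; rewrite -[T in leRHS]subr0; apply: le_trans (ler_norm _) _.
apply: normr_Rintegral_itv => //.
exact: (measurable_along_scaled_orbit e w lip_measurable).
Qed.

(** The averages mean_lip are bounded by Kl and tend to 0 almost everywhere
    for nu, hence for mu. *)
Lemma expectation_lip_mass_cvg0 (mu : probability M R) T : mu `<< nu -> 0 < T ->
  \int[mu]_w lip_mass e T w @[e --> 0^'+] --> 0.
Proof.
move=> munu T0.
have mm N : measurable_fun [set: M] (mean_lip N).
  apply: measurable_funM => //.
  exact: (measurable_orbit_integral hphi lip_measurable LK).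
have mean0 N w : 0 <= mean_lip N w by rewrite mulr_ge0 ?invr_ge0// orbit_integral_ge0.
have meanK N w : mean_lip N w <= Kl.
  have [->|N0] := posnP N; first by rewrite /mean_lip invr0 mul0r.
  rewrite /mean_lip ler_pdivrMl ?ltr0n// mulrC (le_trans (ler_norm _))//.
  exact: (normr_orbit_integral hphi lip_measurable LK).
have bnd (h : M -> R) c : (forall w, 0 <= h w <= c) -> forall w, `|h w| <= c.
  by move=> hc w; have /andP[? ?] := hc w; rewrite ger0_norm.
have aemean : {ae mu, forall w, mean_lip N w @[N --> \oo] --> 0}.
  have [N [mN N0 sN]] := infinite_ergodic_average hphi nu_sigma_finite nu_infinite
    phi_preserving phi_ergodic LK L0 f_lipschitz_integrable.
  by exists N; split => //; move/null_content_dominatesP : munu; exact.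
have Emean : \int[mu]_w mean_lip N w @[N --> \oo] --> 0.
  have -> : (0 : R) = \int[mu]_w (cst 0 w) by rewrite Rintegral_cst// mul0r.
  by apply: (bounded_convergence (K := Kl)) => // N; apply: bnd => w; rewrite mean0/=.
have H : (T + 1) * \int[mu]_w mean_lip (time_index T e) w @[e --> 0^'+] --> 0.
  rewrite -[X in _ --> X](mulr0 (T + 1)); apply: cvgMr.
  exact: cvg_comp (time_index_cvg T0) Emean.
apply: squeeze_cvgr (cvg_cst 0) H; near=> e.
have e0 : 0 < e by near: e; exact: nbhs_right_gt.
have e1 : e <= 1 by near: e; exact: nbhs_right_le.
apply/andP; split; first by apply: Rintegral_ge0 => w _; exact: lip_mass_ge0.
rewrite -RintegralZl//; last first.
  by apply: (@bounded_integrable_probability _ _ _ _ _ Kl) => //; apply: bnd => w;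
    rewrite mean0/=.
apply: (@le_expectation _ _ _ _ _ _ (Kl * T) ((T + 1) * Kl)).
- by apply: measurable_lip_mass => //; exact: ltW.
- by apply: bnd => w; rewrite lip_mass_ge0/= lip_mass_le// ltW.
- exact: measurable_funM.
- apply: bnd => w; have T1 : 0 <= T + 1 by rewrite addr_ge0// ltW.
  by rewrite mulr_ge0//= ler_wpM2l.
- move=> w; apply: le_trans (lip_mass_le_mean w e0 (ltW T0)) _.
  by rewrite ler_wpM2r// lerD2l.
Unshelve. all: by end_near. Qed.

End averaging.

(** * Measurability of random elements *)

Section random_elements.
Context {R : realType} {d : measure_display} {Om : measurableType d}.

Lemma measurable_bigcup_countType (Q : countType) (P : set Q) (F : Q -> set Om) :
  (forall q, P q -> measurable (F q)) -> measurable (\bigcup_(q in P) F q).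
Proof.
move=> mF; rewrite bigcup_mkcond; apply: countable_bigcupT_measurable => //.
by move=> q; case: ifPn => // /set_mem; exact: mF.
Qed.

Lemma measurable_bigcap_countType (Q : countType) (P : set Q) (F : Q -> set Om) :
  (forall q, P q -> measurable (F q)) -> measurable (\bigcap_(q in P) F q).
Proof.
move=> mF; rewrite -[X in measurable X]setCK setC_bigcap; apply: measurableC.
by apply: measurable_bigcup_countType => q Pq; apply: measurableC; exact: mF.
Qed.

Lemma measurable_le_cst (h : Om -> R) c : measurable_fun [set: Om] h ->
  measurable [set w | h w <= c].
Proof.
move=> mh; have := mh measurableT `]-oo, c]%classic (measurable_itv _).
by rewrite setTI; congr measurable; apply/seteqP; split => w /=; rewrite in_itv.
Qed.

Lemma random_element_open (T : topologicalType) (C : set T) (X : Om -> T) :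
  (forall w, C (X w)) -> (forall V, open V -> measurable (X @^-1` V)) ->
  random_element C X.
Proof.
move=> CX mX; split=> //.
suff: <<s @open T >> `<=` [set B | measurable (X @^-1` B)] by [].
apply: smallest_sub => //; split.
- by rewrite /= preimage_set0.
- by move=> A /= mA; rewrite setTD preimage_setC; exact: measurableC.
- by move=> F /= mF; rewrite preimage_bigcup; exact: bigcupT_measurable.
Qed.

(** An open set V is, as far as the values of X are concerned, the union of
    the countably many tests B q that imply V on C. The tests themselves are
    not required to be open: closed conditions on countably many real
    coordinates are enough, and their preimages are visibly measurable. *)
Lemma random_element_countable_base (T : topologicalType) (C : set T)
    (Q : countType) (B : Q -> set T) (X : Om -> T) :
  (forall w, C (X w)) -> (forall q, measurable (X @^-1` B q)) ->
  (forall x V, C x -> open V -> V x ->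
     exists q, B q x /\ (forall y, C y -> B q y -> V y)) ->
  random_element C X.
Proof.
move=> CX mB base; apply: random_element_open => // V oV.
rewrite (_ : X @^-1` V = \bigcup_(q in [set q | forall y, C y -> B q y -> V y])
    X @^-1` B q).
  by apply: measurable_bigcup_countType => q _; exact: mB.
apply/seteqP; split => [w /= Vw|w [q /= qV Bw]]; last exact: qV.
by have [q [Bq qV]] := base _ _ (CX w) oV Vw; exists q.
Qed.

End random_elements.

Section borel_rows.
Context {R : realType} {n : nat} {d : measure_display} {Om : measurableType d}.

Definition grid_row (m : nat) (q : 'rV[int]_n) : 'rV[R]_n :=
  \row_i ((q ord0 i)%:~R / m.+1%:R).

Lemma grid_row_dense m (x : 'rV[R]_n) :
  exists q, `|x - grid_row m q| <= m.+1%:R^-1.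
Proof.
exists (\row_i Num.floor (x ord0 i * m.+1%:R)).
apply: normr_row_le => [|i]; first by rewrite invr_ge0.
have m0 : 0 < m.+1%:R :> R by rewrite ltr0n.
rewrite !mxE.
have -> : x ord0 i - (Num.floor (x ord0 i * m.+1%:R))%:~R / m.+1%:R =
    (x ord0 i * m.+1%:R - (Num.floor (x ord0 i * m.+1%:R))%:~R) / m.+1%:R.
  by rewrite mulrBl mulfK// lt0r_neq0.
rewrite normrM [`|_^-1|]ger0_norm ?invr_ge0// -[leRHS]mul1r ler_wpM2r ?invr_ge0//.
have := floor_itv (x ord0 i * m.+1%:R) => /andP[f1 f2].
rewrite ger0_norm ?subr_ge0// lerBlDl.
by rewrite intrD in f2; exact: ltW.
Qed.

Lemma exists_inv_nat (e : R) : 0 < e -> exists m : nat, m.+1%:R^-1 < e.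
Proof.
move=> e0; exists (Num.truncn e^-1).
rewrite invf_plt ?posrE//; exact/truncnS_gt.
Qed.

Lemma random_element_row (X : Om -> 'rV[R]_n) :
  (forall i, measurable_fun [set: Om] (fun w => X w ord0 i)) ->
  random_element [set: 'rV[R]_n] X.
Proof.
move=> mX.
apply: (@random_element_countable_base _ _ _ _ (nat * 'rV[int]_n)%type
  (fun q => [set x | `|x - grid_row q.1 q.2| <= q.1.+1%:R^-1])) => //.
- move=> [m q] /=.
  rewrite (_ : X @^-1` _ = \bigcap_(i in [set: 'I_n])
      [set w | `|X w ord0 i - grid_row m q ord0 i| <= m.+1%:R^-1]).
    apply: measurable_bigcap_countType => i _; apply: measurable_le_cst.
    by apply: measurableT_comp => //; exact: measurable_funB.
  apply/seteqP; split => [w /= Xw i _|w /= Xw].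
    by have := le_row_normr (X w - grid_row m q) i; rewrite !mxE => /le_trans; apply.
  apply: normr_row_le => [|i]; first by rewrite invr_ge0.
  by have := Xw i Logic.I; rewrite /= !mxE.
- move=> x V _ oV Vx.
  have : nbhs x V by exact: open_nbhs_nbhs.
  rewrite nbhs_ballP => -[r /= r0 xV].
  have r2 : 0 < r / 2 by rewrite divr_gt0.
  have [m mr] := exists_inv_nat r2.
  have [q qx] := grid_row_dense m x.
  exists (m, q); split=> // y _ /= qy; apply: xV.
  rewrite -ball_normE/=.
  rewrite -(subrK (grid_row m q) x) -addrA (le_lt_trans (ler_normD _ _))//.
  by rewrite (splitr r) ltr_leD// ?(le_lt_trans qx)// distrC (le_trans qy)// ltW.
Qed.

End borel_rows.

Section borel_measurability.
Context {R : realType} {n : nat} {d : measure_display} {Om : measurableType d}.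

Lemma measurable_fun_borel_row (Z : Om -> 'rV[R]_n) :
  (forall i, measurable_fun [set: Om] (fun w => Z w ord0 i)) ->
  measurable_fun [set: Om] (Z : Om -> borel 'rV[R]_n).
Proof.
by move=> /random_element_row[_ mZ] _ B mB; rewrite setTI; exact: mZ.
Qed.

Lemma measurable_borel_row_coord (Z : Om -> 'rV[R]_n) i :
  measurable_fun [set: Om] (Z : Om -> borel 'rV[R]_n) ->
  measurable_fun [set: Om] (fun w => Z w ord0 i).
Proof.
move=> mZ; apply: (measurability _ (RGenOInfty.measurableE R)) => // _ [_ [c ->] <-].
rewrite setTI.
have := mZ measurableT ((fun x : 'rV[R]_n => x ord0 i) @^-1` `]c, +oo[%classic).
rewrite setTI; apply; apply: sub_sigma_algebra.
by apply: open_comp => [x _|]; [exact: coord_continuous|exact: interval_open].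
Qed.

End borel_measurability.

(** * Measurability of the solution *)

Section euler_scheme.
Context {R : realType} {n : nat} {d : measure_display} {M : measurableType d}.
Local Notation leb := (@lebesgue_measure R).
Variable phi : R -> M -> M.
Hypothesis hphi : is_flow phi.
Variables (f : 'rV[R]_n -> M -> 'rV[R]_n) (x0 : 'rV[R]_n) (Kb Kl : R).
Hypothesis f_measurable : measurable_fun [set: borel 'rV[R]_n * M]
  (fun p => f p.1 p.2 : borel 'rV[R]_n).
Hypothesis f_bounded : forall x w, `|f x w| <= Kb.
Hypothesis f_lipschitz : forall w x y, `|f x w - f y w| <= Kl * `|x - y|.
Hypothesis Kl0 : 0 <= Kl.
Variables (X : R -> R -> M -> 'rV[R]_n).
Hypothesis X_solution : forall e w, 0 < e ->
  ode_solution (fun t x => f x (phi (t / e) w)) x0 (fun t => X e t w).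

Let Kb0 (w : M) : 0 <= Kb. Proof. exact: le_trans (f_bounded x0 w). Qed.

(** Euler scheme in which the space variable is frozen on each step while
    the motion of the environment phi is integrated exactly. The values at
    the grid times then depend measurably on w as soon as the previous ones
    do. *)
Fixpoint euler (e h : R) (j : nat) (w : M) : 'rV[R]_n :=
  if j is j'.+1 then euler e h j' w +
    vintegral leb `[j'%:R * h, j'.+1%:R * h]
      (fun s => f (euler e h j' w) (phi (s / e) w))
  else x0.

Lemma measurable_frozen_field (Z : M -> 'rV[R]_n) e i :
  (forall i, measurable_fun [set: M] (fun w => Z w ord0 i)) ->
  measurable_fun [set: measurableTypeR R * M]
    (fun p => f (Z p.2) (phi (p.1 / e) p.2) ord0 i).
Proof.
move=> mZ; apply: measurable_borel_row_coord.
apply: (measurableT_comp f_measurable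
  (g := fun p : measurableTypeR R * M => (Z p.2 : borel 'rV[R]_n, phi (p.1 / e) p.2))).
apply: measurable_fun_pair.
  by apply: (measurableT_comp (measurable_fun_borel_row mZ)); exact: measurable_snd.
apply: (measurableT_comp (measurable_flow hphi)
  (g := fun p : measurableTypeR R * M => (p.1 / e : measurableTypeR R, p.2))).
apply: measurable_fun_pair; last exact: measurable_snd.
apply: measurable_funM => //; exact: measurable_fst.
Qed.

Lemma measurable_euler e h j i : 0 <= h ->
  measurable_fun [set: M] (fun w => euler e h j w ord0 i).
Proof.
move=> h0; elim: j i => [|j IH] i; first exact: measurable_cst.
rewrite (_ : (fun w => _) = (fun w => euler e h j w ord0 i +
    \int[leb]_(s in `[j%:R * h, j.+1%:R * h])
      f (euler e h j w) (phi (s / e) w) ord0 i)).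
  apply: measurable_funD; first exact: IH.
  apply: (@measurable_Rintegral_param _ _ _
    (fun p => f (euler e h j p.2) (phi (p.1 / e) p.2) ord0 i) Kb).
  - by rewrite ler_wpM2r// ler_nat.
  - exact: measurable_frozen_field.
  - by move=> p; exact: le_trans (le_row_normr _ _) (f_bounded _ _).
by apply/funext => w; rewrite /= !mxE.
Qed.

Lemma measurable_frozen_slice (z : 'rV[R]_n) e w i :
  measurable_fun [set: R] (fun s => f z (phi (s / e) w) ord0 i).
Proof.
apply: (@measurable_fun_slice _ _ _ (fun p => f z (phi (p.1 / e) p.2) ord0 i)).
by apply: (measurable_frozen_field (Z := fun=> z)) => j; exact: measurable_cst.
Qed.

(** On one step, X stays within Kb * h of its initial point. Adding Kb * h
    to the error absorbs this term and makes the recursion geometric. *)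
Lemma euler_step e h j w : 0 < e -> 0 <= h ->
  `|X e (j.+1%:R * h) w - euler e h j.+1 w| + Kb * h <=
  (1 + Kl * h) * (`|X e (j%:R * h) w - euler e h j w| + Kb * h).
Proof.
move=> e0 h0; set D := `|X e (j%:R * h) w - euler e h j w|.
have a0 : 0 <= j%:R * h by rewrite mulr_ge0.
have ab : j%:R * h <= j.+1%:R * h by rewrite ler_wpM2r// ler_nat.
have len : j.+1%:R * h - j%:R * h = h by rewrite -mulrBl -natrB// subSnn mul1r.
pose G s := f (euler e h j w) (phi (s / e) w).
have D0 : 0 <= Kl * (D + Kb * h).
  by rewrite mulr_ge0 ?addr_ge0 ?mulr_ge0 ?(Kb0 w) ?normr_ge0.
have : `|X e (j.+1%:R * h) w - X e (j%:R * h) w -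
    vintegral leb `[j%:R * h, j.+1%:R * h] G| <= Kl * (D + Kb * h) * h.
  rewrite -[X in _ <= _ * X]len.
  apply: le_trans (ode_solution_compare (X_solution w e0) (K := Kb) (G := G)
    (h := fun=> Kl * (D + Kb * h)) (H := Kl * (D + Kb * h)) _ _ _ _ _ _ _) _ => //.
  - by move=> i; exact: measurable_frozen_slice.
  - by move=> s; exact: f_bounded.
  - by move=> s; rewrite D0 lexx.
  - move=> s js sj; rewrite (le_trans (f_lipschitz _ _ _))// ler_wpM2l//.
    rewrite -(subrK (X e (j%:R * h) w) (X e s w)) -addrA [leRHS]addrC.
    rewrite (le_trans (ler_normD _ _))// lerD//.
    apply: le_trans (solution_displacement f_bounded X_solution w e0 a0 (ltW js)) _.
    by rewrite ler_wpM2l ?(Kb0 w)// -{2}len lerD2r ltW.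
  rewrite Rintegral_cst//= lebesgue_measure_itv/= lte_fin.
  by move: ab; rewrite le_eqVlt => /predU1P[->|->//]; rewrite ltxx subrr.
rewrite [euler _ _ j.+1 _]/= -/G => err.
have : `|X e (j.+1%:R * h) w - (euler e h j w + vintegral leb `[j%:R * h, j.+1%:R * h] G)|
    <= D + Kl * (D + Kb * h) * h.
  rewrite (_ : _ - _ = X e (j%:R * h) w - euler e h j w +
      (X e (j.+1%:R * h) w - X e (j%:R * h) w -
       vintegral leb `[j%:R * h, j.+1%:R * h] G)).
    by rewrite (le_trans (ler_normD _ _))// lerD2l.
  rewrite opprD addrA [RHS]addrA; congr (_ - _).
  by rewrite [RHS]addrC subrKA.
lra.
Qed.

Lemma euler_error e h j w : 0 < e -> 0 <= h ->
  `|X e (j%:R * h) w - euler e h j w| <= Kb * h * expR (j%:R * (Kl * h)).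
Proof.
move=> e0 h0.
have KbH : 0 <= Kb * h by rewrite mulr_ge0// (Kb0 w).
apply: (@le_trans _ _ (`|X e (j%:R * h) w - euler e h j w| + Kb * h)).
  by rewrite lerDl.
rewrite expRM_natl; elim: j => [|j IH].
  rewrite mul0r /= expr0 mulr1; have [-> _ _] := X_solution w e0.
  by rewrite subrr normr0 add0r.
apply: le_trans (euler_step j w e0 h0) _.
apply: (@le_trans _ _ ((1 + Kl * h) * (Kb * h * expR (Kl * h) ^+ j))).
  by rewrite ler_wpM2l// addr_ge0// mulr_ge0.
rewrite exprS mulrCA ler_wpM2l// ler_wpM2r ?exprn_ge0 ?expR_ge0//.
exact: expR_ge1Dx.
Qed.

(** The solutions X e t w are chosen separately for each w. They depend
    measurably on w because they are unique, and more precisely are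
    pointwise limits of the Euler schemes with k + 1 steps. *)
Lemma measurable_solution e t i : 0 < e -> 0 <= t ->
  measurable_fun [set: M] (fun w => X e t w ord0 i).
Proof.
move=> e0 t0.
have tk0 (k : nat) : 0 <= t / k.+1%:R by rewrite divr_ge0.
apply: (measurable_fun_cvg (h := fun k w => euler e (t / k.+1%:R) k.+1 w ord0 i)).
  by move=> k; exact: measurable_euler.
move=> w _; apply/cvgrPdist_le => r r0.
pose B := Kb * t * expR (Kl * t).
near=> k.
have k0 : (k.+1%:R : R) != 0 by rewrite pnatr_eq0.
have -> : X e t w ord0 i - euler e (t / k.+1%:R) k.+1 w ord0 i =
    (X e (k.+1%:R * (t / k.+1%:R)) w - euler e (t / k.+1%:R) k.+1 w) ord0 i.
  have -> : k.+1%:R * (t / k.+1%:R) = t by rewrite mulrCA divff// mulr1.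
  by rewrite [RHS]mxE [X in _ = _ + X]mxE.
apply: le_trans (le_row_normr _ _) _.
apply: le_trans (euler_error k.+1 w e0 (tk0 k)) _.
have -> : k.+1%:R * (Kl * (t / k.+1%:R)) = Kl * t by field.
rewrite mulrA -mulrA [_^-1 * _]mulrC mulrA -/B.
rewrite ler_pdivrMr ?ltr0n// -ler_pdivrMl// mulrC.
near: k; exists (Num.truncn (B / r)) => // k /= Bk.
by apply: le_trans (ltW (truncnS_gt _)) _; rewrite ler_nat ltnS.
Unshelve. all: by end_near. Qed.

End euler_scheme.

(** * Convergence in distribution in metrized subspaces *)

Section metrized_subspace.
Context {R : realType} {T : topologicalType}.

(** The distance rho describes the trace on C of the topology of T. In the
    case of continuous paths, T has more points than C, and two paths that
    agree on [0, S] are at distance 0. *)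
Record metrizes (C : set T) (rho : T -> T -> R) : Prop := Metrizes {
  metrizes_ge0 : forall x y, C x -> C y -> 0 <= rho x y ;
  metrizes_refl : forall x, C x -> rho x x = 0 ;
  metrizes_sym : forall x y, C x -> C y -> rho x y = rho y x ;
  metrizes_triangle : forall x y z, C x -> C y -> C z ->
    rho x z <= rho x y + rho y z ;
  metrizes_nbhs : forall x V, C x -> within C (nbhs x) V <->
    exists2 e : R, 0 < e & forall y, C y -> rho x y < e -> V y }.

Variables (C : set T) (rho : T -> T -> R).
Hypothesis Crho : metrizes C rho.

Lemma within_continuous_metricP (V : normedModType R) (h : T -> V) :
  {within C, continuous h} <->
  (forall x, C x -> forall e, 0 < e -> exists2 dl, 0 < dl &
    forall y, C y -> rho x y < dl -> `|h x - h y| <= e).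
Proof.
rewrite subspace_continuousP; split=> [ch x Cx e e0|ch x Cx].
  by have /cvgrPdist_le/(_ _ e0)/(metrizes_nbhs Crho _ Cx) := ch x Cx.
apply/cvgrPdist_le => e e0.
by apply/(metrizes_nbhs Crho _ Cx); exact: ch.
Qed.

Section lipschitz_envelope.
Variables (h : T -> R) (K : R).
Hypothesis hK : forall x, C x -> `|h x| <= K.

(** The Pasch-Hausdorff envelope: the largest function below h on C which is
    Lipschitz of constant k. *)
Definition lipschitz_envelope (k : nat) (x : T) : R :=
  inf [set h y + k%:R * rho x y | y in C].

Let lb k x : C x -> lbound [set h y + k%:R * rho x y | y in C] (- K).
Proof.
move=> Cx _ [y Cy <-]; rewrite -[leLHS]addr0 lerD//.
  by have := hK Cy; rewrite ler_norml => /andP[].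
by rewrite mulr_ge0// (metrizes_ge0 Crho).
Qed.

Let env_le k x y : C x -> C y -> lipschitz_envelope k x <= h y + k%:R * rho x y.
Proof.
by move=> Cx Cy; apply: ge_inf; [exists (- K); exact: lb|exists y].
Qed.

Let le_env k x c : C x -> (forall y, C y -> c <= h y + k%:R * rho x y) ->
  c <= lipschitz_envelope k x.
Proof.
move=> Cx cy; apply: lb_le_inf; first by exists (h x + k%:R * rho x x), x.
by move=> _ [y Cy <-]; exact: cy.
Qed.

Lemma lipschitz_envelope_le k x : C x -> lipschitz_envelope k x <= h x.
Proof.
by move=> Cx; apply: le_trans (env_le k Cx Cx) _; rewrite (metrizes_refl Crho)// mulr0 addr0.
Qed.

Lemma normr_lipschitz_envelope k x : C x -> `|lipschitz_envelope k x| <= K.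
Proof.
move=> Cx; rewrite ler_norml; apply/andP; split.
  by apply: le_env => // y Cy; apply: (lb (k := k) Cx); exists y.
apply: le_trans (lipschitz_envelope_le k Cx) _.
exact: le_trans (ler_norm _) (hK Cx).
Qed.

Lemma lipschitz_envelope_lipschitz k x y : C x -> C y ->
  lipschitz_envelope k x - lipschitz_envelope k y <= k%:R * rho x y.
Proof.
move=> Cx Cy; rewrite lerBlDr addrC -lerBlDr; apply: le_env => // z Cz.
rewrite lerBlDr; apply: le_trans (env_le k Cx Cz) _.
rewrite -addrA lerD2l -mulrDr ler_wpM2l// addrC.
exact: (metrizes_triangle Crho).
Qed.

Lemma normr_lipschitz_envelopeB k x y : C x -> C y ->
  `|lipschitz_envelope k x - lipschitz_envelope k y| <= k%:R * rho x y.
Proof.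
move=> Cx Cy; rewrite ler_norml lerNl opprB lipschitz_envelope_lipschitz// andbT.
by rewrite (metrizes_sym Crho)// lipschitz_envelope_lipschitz.
Qed.

Lemma continuous_lipschitz_envelope k :
  {within C, continuous (lipschitz_envelope k)}.
Proof.
apply/within_continuous_metricP => x Cx e e0.
exists (e / k.+1%:R); first by rewrite divr_gt0.
move=> y Cy xy; apply: le_trans (normr_lipschitz_envelopeB k Cx Cy) _.
move: xy; rewrite ltr_pdivlMr// mulrC => /ltW; apply: le_trans.
by rewrite ler_wpM2r ?ler_nat// (metrizes_ge0 Crho).
Qed.

(** The infimum defining the envelope is close to h x over the points y near
    x by continuity, and over the other ones the penalty k * rho x y exceeds
    the oscillation 2 * K of h for k large. *)
Lemma lipschitz_envelope_cvg x : {within C, continuous h} -> C x ->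
  lipschitz_envelope k x @[k --> \oo] --> h x.
Proof.
move=> ch Cx; apply/cvgrPdist_le => e e0.
have [dl dl0 hdl] := (within_continuous_metricP h).1 ch x Cx e e0.
near=> k.
rewrite ger0_norm ?subr_ge0 ?lipschitz_envelope_le//.
rewrite lerBlDr addrC -lerBlDr; apply: le_env => // y Cy.
have kr0 : 0 <= k%:R * rho x y by rewrite mulr_ge0// (metrizes_ge0 Crho).
have [xy|xy] := ltP (rho x y) dl.
  have := hdl y Cy xy; rewrite ler_norml => /andP[_]; lra.
have : K *+ 2 <= k%:R * dl.
  rewrite -ler_pdivrMr//; near: k.
  exists (Num.truncn (K *+ 2 / dl)).+1 => // k /= tk.
  by apply: le_trans (ltW (truncnS_gt _)) _; rewrite ler_nat.
move=> Kk; have : K *+ 2 <= k%:R * rho x y.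
  by apply: le_trans Kk _; rewrite ler_wpM2l.
have := hK Cx; have := hK Cy; rewrite !ler_norml mulr2n => /andP[? ?] /andP[? ?]; lra.
Unshelve. all: by end_near. Qed.

End lipschitz_envelope.
End metrized_subspace.

Section continuous_functions_of_random_elements.
Context {R : realType} {d : measure_display} {Om : measurableType d}.

(** As h is continuous on C only, the preimage of an open half-line is the
    trace on C of an open set of T: the interior of the set of points that
    satisfy the condition if they are in C. *)
Lemma measurable_fun_random_element (T : topologicalType) (C : set T)
    (X : Om -> T) (h : T -> R) :
  random_element C X -> {within C, continuous h} ->
  measurable_fun [set: Om] (fun w => h (X w)).
Proof.
move=> [CX mX] ch.
apply: (measurability _ (RGenOInfty.measurableE R)) => // _ [_ [c ->] <-].
rewrite setTI.
pose V := interior [set y | C y -> c < h y].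
rewrite (_ : _ @^-1` _ = X @^-1` V).
  by apply: mX; apply: sub_sigma_algebra; exact: open_interior.
apply/seteqP; split => w /=; rewrite in_itv/= andbT.
  move=> cX; move/subspace_continuousP : ch => /(_ _ (CX w)) => H.
  by apply: (H [set z | c < z]); exact: lt_nbhsr.
by move=> /interior_subset; apply.
Qed.

Lemma random_element_comp (T T' : topologicalType) (C : set T) (C' : set T')
    (X : Om -> T) (g : T -> T') :
  random_element C X -> {within C, continuous g} -> (forall x, C x -> C' (g x)) ->
  random_element C' (fun w => g (X w)).
Proof.
move=> [CX mX] cg gC; apply: random_element_open => [w|V oV]; first exact: gC.
pose U := interior [set y | C y -> V (g y)].
rewrite (_ : _ @^-1` _ = X @^-1` U).
  by apply: mX; apply: sub_sigma_algebra; exact: open_interior.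
apply/seteqP; split => w /=.
  move=> VX; move/subspace_continuousP : cg => /(_ _ (CX w)) => H.
  by apply: H; exact: open_nbhs_nbhs.
by move=> /interior_subset; apply.
Qed.

Lemma within_continuous_comp (T T' : topologicalType) (C : set T) (C' : set T')
    (g : T -> T') (h : T' -> R) :
  {within C, continuous g} -> (forall x, C x -> C' (g x)) ->
  {within C', continuous h} -> {within C, continuous (h \o g)}.
Proof.
move=> /subspace_continuousP cg gC /subspace_continuousP ch.
apply/subspace_continuousP => x Cx.
have gx : g y @[y --> within C (nbhs x)] --> within C' (nbhs (g x)).
  move=> V /= VC'; have := cg x Cx _ VC'; rewrite /nbhs/= /within/=.
  by apply: filterS => y VC Cy; apply: VC => //; exact: gC.
exact: cvg_comp gx (ch _ (gC _ Cx)).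
Qed.

End continuous_functions_of_random_elements.

Section slutsky.
Context {R : realType} {I : Type} (F : set_system I) {FF : ProperFilter F}.
Context {d : measure_display} {Om : measurableType d} (P : probability Om R).
Context {d' : measure_display} {Om' : measurableType d'}.
Variable P' : probability Om' R.

Lemma cvg_in_distribution_comp (T T' : topologicalType) (C : set T)
    (C' : set T') (X : I -> Om -> T) (Y : Om' -> T) (g : T -> T') :
  {within C, continuous g} -> (forall x, C x -> C' (g x)) ->
  cvg_in_distribution C F P X P' Y ->
  cvg_in_distribution C' F P (fun i w => g (X i w)) P' (fun v => g (Y v)).
Proof.
move=> cg gC [rX rY cvXY]; split.
- by apply: filterS rX => i rXi; exact: random_element_comp rXi cg gC.
- exact: random_element_comp rY cg gC.
- move=> h ch [K hK]; apply: (cvXY (h \o g)).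
    exact: within_continuous_comp cg gC ch.
  by exists K => x Cx; apply: hK; exact: gC.
Qed.

(** The variables Q i are tight because they converge in distribution: up to
    a small probability, measured by the continuous cutoff theta B, they are
    at most B + 1, and then the product is at most B + 2 times dl i. *)
Lemma tight_mul_cvg0 (dl Q : I -> Om -> R) (Q' : Om' -> R) (D : R) :
  (\forall i \near F, measurable_fun [set: Om] (dl i) /\
     forall w, 0 <= dl i w <= D) ->
  \int[P]_w dl i w @[i --> F] --> 0 ->
  (\forall i \near F, forall w, 0 <= Q i w) ->
  cvg_in_distribution [set: R] F P Q P' Q' ->
  \int[P]_w Num.min 1 (dl i w * (Q i w + 1)) @[i --> F] --> 0.
Proof.
move=> mdl dl0 Q0 [rQ rQ' cvQ].
pose theta (B : nat) (q : R) := Num.min 1 (Num.max 0 (q - B%:R)).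
have theta_cont B : {within [set: R], continuous (theta B)}.
  apply/continuous_subspaceT => q.
  apply: (@continuous_min _ _ (cst 1) (fun q : R => Num.max 0 (q - B%:R)) q).
    exact: cvg_cst.
  apply: (@continuous_max _ _ (cst 0) (fun q : R => q - B%:R) q).
    exact: cvg_cst.
  by apply: cvgB; [exact: cvg_id|exact: cvg_cst].
have theta01 B q : 0 <= theta B q <= 1.
  by rewrite /theta le_min ler01 le_max lexx/= ge_min lexx.
have theta1 B q : `|theta B q| <= 1.
  by have /andP[? ?] := theta01 B q; rewrite ger0_norm.
have Etheta : \int[P']_v theta B (Q' v) @[B --> \oo] --> 0.
  have -> : (0 : R) = \int[P']_v (cst 0 v) by rewrite Rintegral_cst// mul0r.
  apply: (@bounded_convergence _ _ _ _ _ _ 1) => //.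
  - by move=> B; exact: measurable_fun_random_element rQ' (theta_cont B).
  - apply: aeW => v; apply/cvgrPdist_le => e e0; near=> B.
    rewrite /theta (_ : Num.max _ _ = 0) ?min_r ?subrr ?normr0 ?ltW//.
    apply/max_idPl; rewrite subr_le0; near: B.
    exists (Num.truncn (Q' v)).+1 => // B /= tB.
    by apply: le_trans (ltW (truncnS_gt _)) _; rewrite ler_nat.
apply/cvgrPdist_le => e e0.
have e3 : 0 < e / 3 by rewrite divr_gt0.
have [B thB] : exists B, \int[P']_v theta B (Q' v) <= e / 3.
  move/cvgrPdist_le : Etheta => /(_ _ e3)[B _ hB]; exists B.
  by have := hB B (leqnn B); rewrite /= sub0r normrN; apply: le_trans (ler_norm _).
have thQ : \forall i \near F, \int[P]_w theta B (Q i w) <= e / 3 + e / 3.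
  have bB : exists K, forall x, [set: R] x -> `|theta B x| <= K by exists 1.
  have := cvQ _ (theta_cont B) bB.
  move/cvgrPdist_le => /(_ _ e3); apply: filterS => i.
  by rewrite ler_norml => /andP[+ _]; lra.
pose c : R := B%:R + 2.
have c0 : 0 < c by rewrite ltr_wpDl.
have dlc : \forall i \near F, \int[P]_w dl i w <= e / 3 / c.
  have ec : 0 < e / 3 / c by rewrite divr_gt0.
  move/cvgrPdist_le : dl0 => /(_ _ ec); apply: filterS => i.
  by rewrite sub0r normrN; apply: le_trans (ler_norm _).
near=> i.
have [mdli dlD] : measurable_fun [set: Om] (dl i) /\ forall w, 0 <= dl i w <= D.
  by near: i.
have rQi : random_element [set: R] (Q i) by near: i.
have mQi : measurable_fun [set: Om] (Q i).
  by apply: (measurable_fun_random_element (h := id) rQi);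
    apply/continuous_subspaceT => q; exact: cvg_id.
have mm : measurable_fun [set: Om] (fun w => Num.min 1 (dl i w * (Q i w + 1))).
  apply: measurable_minr => //; apply: measurable_funM => //.
  exact: measurable_funD.
have mth : measurable_fun [set: Om] (fun w => theta B (Q i w)).
  exact: measurable_fun_random_element rQi (theta_cont B).
have Qi0 w : 0 <= Q i w by move: w; near: i.
have min0 w : 0 <= Num.min 1 (dl i w * (Q i w + 1)).
  by have /andP[? ?] := dlD w; rewrite le_min ler01 mulr_ge0// addr_ge0.
rewrite sub0r normrN ger0_norm; last by apply: Rintegral_ge0.
have dlD' w : `|dl i w| <= D by have /andP[? ?] := dlD w; rewrite ger0_norm.
apply: (@le_trans _ _ (\int[P]_w (c * dl i w + theta B (Q i w)))).
  apply: (@le_expectation _ _ _ _ _ _ 1 (c * D + 1)) => //.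
  - by move=> w; rewrite ger0_norm// ge_min lexx.
  - by apply: measurable_funD => //; exact: measurable_funM.
  - move=> w; rewrite (le_trans (ler_normD _ _))// lerD// normrM gtr0_norm//.
    by rewrite ler_wpM2l// ltW.
  - move=> w; have /andP[dl0w _] := dlD w.
    have [QB|QB] := leP (Q i w) (B%:R + 1).
      rewrite ge_min; apply/orP; right.
      apply: (@le_trans _ _ (c * dl i w)).
        by rewrite mulrC ler_wpM2r// /c; lra.
      by rewrite lerDl; have /andP[] := theta01 B (Q i w).
    have -> : theta B (Q i w) = 1.
      by rewrite /theta min_l// le_max lerBrDl (ltW QB) orbT.
    by rewrite ge_min lerDr mulr_ge0// ltW.
rewrite RintegralD//; last 2 first.
- apply: (@bounded_integrable_probability _ _ _ _ _ (c * D)).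
    exact: measurable_funM.
  by move=> w; rewrite normrM gtr0_norm// ler_wpM2l// ltW.
- exact: (@bounded_integrable_probability _ _ _ _ _ 1).
rewrite RintegralZl//; last exact: (@bounded_integrable_probability _ _ _ _ _ D).
have h1 : c * \int[P]_w dl i w <= e / 3.
  by rewrite mulrC -ler_pdivlMr//; near: i.
have h2 : \int[P]_w theta B (Q i w) <= e / 3 + e / 3 by near: i.
lra.
Unshelve. all: by end_near. Qed.

(** For test functions that are Lipschitz for rho, the expectations along X
    and V differ by a multiple of the expectation of r. For a bounded
    continuous h, the Lipschitz envelopes of h bound the expectations of h
    along X from below, and those of - h bound them from above. *)
Lemma slutsky (T : topologicalType) (C : set T) (rho : T -> T -> R)
    (X V : I -> Om -> T) (Y : Om' -> T) (r : I -> Om -> R) :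
  metrizes C rho ->
  cvg_in_distribution C F P V P' Y ->
  (\forall i \near F, random_element C (X i)) ->
  (\forall i \near F, measurable_fun [set: Om] (r i) /\
    forall w, Num.min 1 (rho (X i w) (V i w)) <= r i w <= 1) ->
  \int[P]_w r i w @[i --> F] --> 0 ->
  cvg_in_distribution C F P X P' Y.
Proof.
move=> Crho [rV rY cvV] rX mr r0; split=> // h0 ch0 [K0 hK0].
have step (h : T -> R) : {within C, continuous h} ->
    (exists K, forall x, C x -> `|h x| <= K) -> forall e, 0 < e ->
    \forall i \near F, \int[P']_v h (Y v) - e <= \int[P]_w h (X i w).
  move=> ch [K hK] e e0.
  have e3 : 0 < e / 3 by rewrite divr_gt0.
  pose hk k := lipschitz_envelope C rho h k.
  have chk k : {within C, continuous (hk k)}.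
    exact: (continuous_lipschitz_envelope Crho hK).
  have hkK k x : C x -> `|hk k x| <= K.
    exact: (normr_lipschitz_envelope Crho hK).
  have Ehk : \int[P']_v hk k (Y v) @[k --> \oo] --> \int[P']_v h (Y v).
    apply: (@bounded_convergence _ _ _ _ _ _ K).
    - by move=> k; exact: measurable_fun_random_element rY (chk k).
    - exact: measurable_fun_random_element rY ch.
    - by move=> k v; apply: hkK; exact: rY.1.
    - by apply: aeW => v; apply: (lipschitz_envelope_cvg Crho hK ch); exact: rY.1.
  have [k hke] : exists k, \int[P']_v h (Y v) - e / 3 <= \int[P']_v hk k (Y v).
    move/cvgrPdist_le : Ehk => /(_ _ e3)[k _ Hk]; exists k.
    by have := Hk k (leqnn k); rewrite ler_norml => /andP[_]; lra.
  have hkV : \forall i \near F,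
      \int[P']_v hk k (Y v) - e / 3 <= \int[P]_w hk k (V i w).
    have bk : exists K, forall x, C x -> `|hk k x| <= K by exists K; exact: hkK.
    have := cvV _ (chk k) bk.
    move/cvgrPdist_le => /(_ _ e3); apply: filterS => i.
    by rewrite ler_norml => /andP[_]; lra.
  (* An envelope of constant k and bound K varies by at most min (2 * K) (k
     * rho) <= c * min 1 rho. *)
  pose c := K *+ 2 + k%:R.
  have [v0 _] : [set: Om'] !=set0.
    apply/set0P/eqP => E; have := probability_setT P'.
    by rewrite E measure0 => /eqP; rewrite eq_sym onee_eq0.
  have K0' : 0 <= K by apply: le_trans (normr_ge0 _) (hK _ (rY.1 v0)).
  have c0 : 0 <= c by rewrite addr_ge0// mulrn_wge0.
  have c10 : 0 < c + 1 by rewrite ltr_wpDl.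
  have rc : \forall i \near F, \int[P]_w r i w <= e / 3 / (c + 1).
    have ec : 0 < e / 3 / (c + 1) by rewrite divr_gt0.
    move/cvgrPdist_le : r0 => /(_ _ ec); apply: filterS => i.
    by rewrite sub0r normrN; apply: le_trans (ler_norm _).
  near=> i.
  have rXi : random_element C (X i) by near: i.
  have rVi : random_element C (V i) by near: i.
  have [mri ri1] : measurable_fun [set: Om] (r i) /\
    forall w, Num.min 1 (rho (X i w) (V i w)) <= r i w <= 1 by near: i.
  have mX := measurable_fun_random_element rXi (chk k).
  have mV := measurable_fun_random_element rVi (chk k).
  have mhX := measurable_fun_random_element rXi ch.
  have ri01 w : `|r i w| <= 1.
    have /andP[rw r1] := ri1 w; rewrite ger0_norm//; apply: le_trans rw.
    by rewrite le_min ler01 (metrizes_ge0 Crho)//; [exact: rXi.1|exact: rVi.1].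
  have ge1 : \int[P]_w hk k (X i w) <= \int[P]_w h (X i w).
    apply: (@le_expectation _ _ _ _ _ _ K K) => //.
    - by move=> w; apply: hkK; exact: rXi.1.
    - by move=> w; apply: hK; exact: rXi.1.
    - by move=> w; apply: (lipschitz_envelope_le Crho hK); exact: rXi.1.
  have ge2 : \int[P]_w hk k (V i w) <= \int[P]_w (hk k (X i w) + c * r i w).
    apply: (@le_expectation _ _ _ _ _ _ K (K + c)) => //.
    - by move=> w; apply: hkK; exact: rVi.1.
    - by apply: measurable_funD => //; exact: measurable_funM.
    - move=> w; rewrite (le_trans (ler_normD _ _))// lerD//.
        by apply: hkK; exact: rXi.1.
      by rewrite normrM ger0_norm// ler_piMr.
    - move=> w; have CX := rXi.1 w; have CV := rVi.1 w.
      have /andP[rw r1] := ri1 w.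
      apply: (@le_trans _ _ (hk k (X i w) + c * Num.min 1 (rho (X i w) (V i w)))).
        rewrite -lerBlDl; have [rho1|rho1] := leP 1 (rho (X i w) (V i w)).
          have := hkK k _ CX; have := hkK k _ CV.
          rewrite !ler_norml mulr1 /c mulr2n => /andP[? ?] /andP[? ?].
          have : (0 : R) <= k%:R by []. lra.
        apply: le_trans (lipschitz_envelope_lipschitz Crho hK k CV CX) _.
        rewrite (metrizes_sym Crho CV CX) ler_wpM2r ?(metrizes_ge0 Crho)//.
        by rewrite /c lerDr mulrn_wge0.
      by rewrite lerD2l ler_wpM2l.
  rewrite RintegralD// in ge2; last 2 first.
  - apply: (@bounded_integrable_probability _ _ _ _ _ K) => // w.
    by apply: hkK; exact: rXi.1.
  - apply: (@bounded_integrable_probability _ _ _ _ _ c).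
      exact: measurable_funM.
    by move=> w; rewrite normrM ger0_norm// ler_piMr.
  rewrite RintegralZl// in ge2; last exact: (@bounded_integrable_probability _ _ _ _ _ 1).
  have cr : c * \int[P]_w r i w <= e / 3.
    have rc' : \int[P]_w r i w <= e / 3 / (c + 1) by near: i.
    apply: le_trans (ler_wpM2l c0 rc') _.
    by rewrite mulrCA ler_piMr ?(ltW e3)// ler_pdivrMr// mul1r lerDl.
  have hkV' : \int[P']_v hk k (Y v) - e / 3 <= \int[P]_w hk k (V i w) by near: i.
  lra.
apply/cvgrPdist_le => e e0.
have cN : {within C, continuous (fun x => - h0 x)}.
  apply/(within_continuous_metricP Crho) => x Cx e' e'0.
  have [dl dl0 H] := (within_continuous_metricP Crho h0).1 ch0 x Cx e' e'0.
  by exists dl => // y Cy xy; rewrite -opprD normrN; exact: H.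
have hKP : exists K, forall x, C x -> `|h0 x| <= K by exists K0.
have up := step h0 ch0 hKP e e0.
have hKN : exists K, forall x, C x -> `|- h0 x| <= K.
  by exists K0 => x Cx; rewrite normrN; exact: hK0.
have dn := step _ cN hKN e e0.
near=> i.
have rXi : random_element C (X i) by near: i.
have mX := measurable_fun_random_element rXi ch0.
have mY := measurable_fun_random_element rY ch0.
have up' : \int[P']_v h0 (Y v) - e <= \int[P]_w h0 (X i w) by near: i.
have dn' : \int[P']_v - h0 (Y v) - e <= \int[P]_w - h0 (X i w) by near: i.
have NP (d1 : measure_display) (O1 : measurableType d1) (P1 : probability O1 R)
    (Z : O1 -> T) : random_element C Z ->
    \int[P1]_w - h0 (Z w) = - \int[P1]_w h0 (Z w).
  move=> rZ; rewrite -mulN1r -RintegralZl//.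
    by apply: eq_Rintegral => w _; rewrite mulN1r.
  apply: (@bounded_integrable_probability _ _ _ _ _ K0).
    exact: measurable_fun_random_element rZ ch0.
  by move=> w; apply: hK0; exact: rZ.1.
rewrite !NP// in dn'.
by rewrite ler_norml; apply/andP; split; lra.
Unshelve. all: by end_near. Qed.

End slutsky.

(** * The space of continuous paths *)

Section norm_metrizes.
Context {R : realType}.

Lemma metrizes_norm (V : normedModType R) (C : set V) :
  metrizes C (fun x y => `|x - y|).
Proof.
split.
- by [].
- by move=> x _; rewrite subrr normr0.
- by move=> x y _ _; rewrite distrC.
- by move=> x y z _ _ _; exact: ler_distD.
- move=> x V' Cx; split.
    move=> /nbhs_ballP[e /= e0 xV]; exists e => // y Cy xy; apply: xV => //.
    by rewrite -ball_normE.
  move=> [e e0 xV]; apply/nbhs_ballP; exists e => // y /=; rewrite -ball_normE/= => xy Cy.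
  exact: xV.
Qed.

Lemma within_continuous_normP (V W : normedModType R) (C : set V) (h : V -> W) :
  {within C, continuous h} <->
  (forall x, C x -> forall e, 0 < e -> exists2 dl, 0 < dl &
    forall y, C y -> `|x - y| < dl -> `|h x - h y| <= e).
Proof. exact: (within_continuous_metricP (metrizes_norm C)). Qed.

End norm_metrizes.

Section path_space_metric.
Context {R : realType} {n : nat} (S : R).
Hypothesis S0 : 0 < S.
Local Notation paths := (@continuous_paths R n S).
Implicit Types x y : R -> 'rV[R]_n.

Definition sup_norm x : R := sup [set `|x t| | t in `[0, S]].
Definition sup_dist (x y : path_space n S) : R := sup_norm (fun t => x t - y t).

Let I0 : `[0, S]%classic (0 : R). Proof. by rewrite /= in_itv/= lexx ltW. Qed.

Lemma sup_norm_le x c : (forall t, 0 <= t <= S -> `|x t| <= c) -> sup_norm x <= c.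
Proof.
move=> xc; apply: sup_le_ub; first by exists `|x 0|, 0.
by move=> y [t /=]; rewrite in_itv/= => tS <-; exact: xc.
Qed.

Lemma path_bounded x : paths x -> exists c, forall t, 0 <= t <= S -> `|x t| <= c.
Proof.
move=> cx; have := continuous_compact cx (@segment_compact R 0 S).
move=> /compact_bounded[K [_ xK]]; exists (K + 1) => t tS.
by apply: (xK (K + 1)); [rewrite ltrDl|exists t => //; rewrite /= in_itv].
Qed.

Lemma le_sup_norm x t : paths x -> 0 <= t <= S -> `|x t| <= sup_norm x.
Proof.
move=> /path_bounded[c xc] tS; apply: sup_ubound; last first.
  by exists t => //; rewrite /= in_itv.
by exists c => y [s /=]; rewrite in_itv/= => sS <-; exact: xc.
Qed.

Lemma continuous_pathsB x y : paths x -> paths y -> paths (fun t => x t - y t).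
Proof.
move=> /within_continuous_normP cx /within_continuous_normP cy.
apply/within_continuous_normP => t tS e e0.
have e2 : 0 < e / 2 by rewrite divr_gt0.
have [d1 d10 h1] := cx t tS _ e2; have [d2 d20 h2] := cy t tS _ e2.
exists (Num.min d1 d2); first by rewrite lt_min d10.
move=> s sS; rewrite lt_min => /andP[s1 s2].
have -> : x t - y t - (x s - y s) = (x t - x s) - (y t - y s).
  by rewrite !opprD !opprK (addrACA (x t)).
by rewrite (splitr e) (le_trans (ler_normB _ _))// lerD ?h1 ?h2.
Qed.

Lemma le_sup_dist x y t : paths x -> paths y -> 0 <= t <= S ->
  `|x t - y t| <= sup_dist x y.
Proof. by move=> cx cy; exact: (le_sup_norm (continuous_pathsB cx cy)). Qed.

Lemma metrizes_sup_dist : metrizes paths sup_dist.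
Proof.
have h0 : (0 : R) <= 0 <= S by rewrite lexx ltW.
split.
- by move=> x y cx cy; apply: le_trans (le_sup_dist cx cy h0).
- move=> x cx; apply/eqP; rewrite eq_le; apply/andP; split.
    by apply: sup_norm_le => t _; rewrite subrr normr0.
  exact: le_trans (le_sup_dist cx cx h0).
- by move=> x y _ _; congr sup; apply/seteqP; split => z [t tS <-]; exists t => //;
    rewrite distrC.
- move=> x y z cx cy cz; apply: sup_norm_le => t tS.
  by rewrite (le_trans (ler_distD (y t) _ _))// lerD// le_sup_dist.
- move=> x V cx; split.
    move=> /uniform_nbhs[E []]; rewrite -entourage_from_ballE => -[e /= e0 eE] EV.
    exists e => // y cy xy; apply: EV => // t tS; apply: eE => /=.
    rewrite -ball_normE/=; apply: le_lt_trans xy.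
    by apply: le_sup_dist => //; move: tS; rewrite /= in_itv.
  move=> [e e0 xV]; apply/uniform_nbhs.
  have e2 : 0 < e / 2 by rewrite divr_gt0.
  exists [set ab | ball ab.1 (e / 2) ab.2]; split.
    by rewrite -entourage_from_ballE; exists (e / 2).
  move=> y /= xy cy; apply: xV => //; apply: (@le_lt_trans _ _ (e / 2)).
    apply: sup_norm_le => t tS; have := xy t.
    by rewrite in_itv/= -ball_normE/= => /(_ tS)/ltW.
  by rewrite ltr_pdivrMr// ltr_pMr// ltr1n.
Qed.

Lemma continuous_sup_norm : {within paths, continuous (sup_norm : path_space n S -> R)}.
Proof.
apply/(within_continuous_metricP metrizes_sup_dist) => x cx e e0.
exists e => // y cy xy; apply: le_trans (ltW xy).
have tri z1 z2 : paths z1 -> paths z2 -> sup_norm z1 - sup_norm z2 <= sup_dist z1 z2.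
  move=> c1 c2; rewrite lerBlDr; apply: sup_norm_le => t tS.
  rewrite -(subrK (z2 t) (z1 t)) (le_trans (ler_normD _ _))// lerD//.
    exact: le_sup_dist.
  exact: le_sup_norm.
rewrite ler_norml lerNl opprB tri// andbT (metrizes_sym metrizes_sup_dist)//.
exact: tri.
Qed.

(** Heine's theorem by interval induction. Two times of [0, S] are compared
    when they are close to a common point of [u, v]: stated in this way, the
    property is inherited by the union of two adjacent intervals with the
    smaller of the two radii. *)
Lemma path_uniformly_continuous x e : paths x -> 0 < e ->
  exists2 dl, 0 < dl & forall s t, 0 <= s <= S -> 0 <= t <= S ->
    `|s - t| < dl -> `|x s - x t| <= e.
Proof.
move=> /within_continuous_normP cx e0.
pose P (u v : R) := exists2 dl : R, 0 < dl & forall p, u <= p <= v ->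
  forall s t, 0 <= s <= S -> 0 <= t <= S -> `|s - p| < dl -> `|t - p| < dl ->
  `|x s - x t| <= e.
suff [dl dl0 xdl] : P 0 S.
  exists dl => // s t sS tS st; apply: (xdl t) => //; rewrite ?subrr ?normr0//.
apply: interval_induction; first exact: ltW.
  move=> r s t _ rs st _ [d1 d10 h1] [d2 d20 h2].
  exists (Num.min d1 d2); first by rewrite lt_min d10.
  move=> p /andP[rp pt] a b aS bS; rewrite !lt_min => /andP[a1 a2] /andP[b1 b2].
  have [ps|sp] := leP p s; first by apply: (h1 p) => //; rewrite rp.
  by apply: (h2 p) => //; rewrite (ltW sp).
move=> p p0 pS; have e2 : 0 < e / 2 by rewrite divr_gt0.
have pI : `[0, S]%classic p by rewrite /= in_itv/= p0.
have [dl dl0 xdl] := cx p pI _ e2.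
exists (dl / 2); first by rewrite divr_gt0.
move=> u v u0 up pv vS uvdl; exists (dl / 2); first by rewrite divr_gt0.
move=> q /andP[uq qv] s t sS tS sq tq.
have near_p r : `|r - q| < dl / 2 -> `|p - r| < dl.
  by rewrite !ltr_norml => /andP[? ?]; apply/andP; split; lra.
rewrite (le_trans (ler_distD (x p) _ _))// (splitr e) lerD//.
  by rewrite distrC; apply: xdl; [rewrite /= in_itv|exact: near_p].
by apply: xdl; [rewrite /= in_itv|exact: near_p].
Qed.

Definition grid_time (l j : nat) : R := S * (j%:R / l.+1%:R).
(** The index of the cell [grid_time l j, grid_time l j.+1[ that contains t. *)
Definition cell (l : nat) (t : R) : nat := Num.truncn (t / S * l.+1%:R).

Lemma cellP l t : 0 <= t <= S ->
  [/\ (cell l t <= l.+1)%N, 0 <= grid_time l (cell l t) <= S &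
      `|t - grid_time l (cell l t)| <= S / l.+1%:R].
Proof.
move=> /andP[t0 tS]; have l0 : 0 < l.+1%:R :> R by rewrite ltr0n.
have y0 : 0 <= t / S * l.+1%:R by rewrite mulr_ge0// divr_ge0// ltW.
have /andP[c1 c2] := truncn_itv y0; rewrite -/(cell l t) in c1 c2.
have c3 : (cell l t)%:R <= l.+1%:R :> R.
  apply: le_trans c1 _; rewrite ler_piMl// ler_pdivrMr// mul1r//.
have gt : grid_time l (cell l t) <= t.
  rewrite /grid_time mulrA ler_pdivrMr// mulrC -ler_pdivlMr//.
  by rewrite mulrAC.
split; first by move: c3; rewrite ler_nat.
  rewrite (le_trans gt)// andbT mulr_ge0 ?divr_ge0//; exact: ltW.
rewrite ger0_norm ?subr_ge0// lerBlDr /grid_time.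
have tc : t <= (cell l t).+1%:R / l.+1%:R * S.
  by rewrite -ler_pdivrMr// ler_pdivlMr// ltW.
apply: le_trans tc _; rewrite -addn1 natrD.
by rewrite !mulrDl mul1r addrC [_^-1 * S]mulrC [_ * S]mulrC.
Qed.

(** C([0, S]) is separable: step functions with values on a grid of row
    vectors approximate every continuous path, and form a countable family.
    A test bounds the distance to a step function at the times of all the
    regular grids, which are countably many and dense; a continuous path
    satisfying it satisfies the bound on the differences of continuous paths
    at all times. *)
Lemma random_element_path {d : measure_display} {Om : measurableType d}
    (X : Om -> path_space n S) :
  (forall w, paths (X w)) ->
  (forall t i, 0 <= t <= S -> measurable_fun [set: Om] (fun w => X w t ord0 i)) ->
  random_element paths X.
Proof.
move=> cX mX.
pose step (q : nat * nat * seq 'rV[int]_n) (t : R) : 'rV[R]_n :=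
  grid_row q.1.1 (nth 0 q.2 (cell q.1.2 t)).
pose B (q : nat * nat * seq 'rV[int]_n) : set (path_space n S) :=
  [set x | forall lj : nat * nat, 0 <= grid_time lj.1 lj.2 <= S ->
     `|x (grid_time lj.1 lj.2) - step q (grid_time lj.1 lj.2)| <= q.1.1.+1%:R^-1 * 2].
apply: (random_element_countable_base (B := B)) => //.
- move=> q.
  rewrite (_ : X @^-1` B q = \bigcap_(lj in [set lj : nat * nat |
      0 <= grid_time lj.1 lj.2 <= S])
    \bigcap_(i in [set: 'I_n]) [set w | `|X w (grid_time lj.1 lj.2) ord0 i -
      step q (grid_time lj.1 lj.2) ord0 i| <= q.1.1.+1%:R^-1 * 2]).
    apply: measurable_bigcap_countType => lj ljS.
    apply: measurable_bigcap_countType => i _; apply: measurable_le_cst.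
    apply: measurableT_comp => //; apply: measurable_funB => //; exact: mX.
  apply/seteqP; split => [w Bw lj ljS i _|w Bw lj ljS].
    have := le_row_normr (X w (grid_time lj.1 lj.2) - step q (grid_time lj.1 lj.2)) i.
    by rewrite !mxE => /le_trans; apply; exact: (Bw lj ljS).
  apply: normr_row_le => [|i]; first by rewrite mulr_ge0// invr_ge0.
  by have := Bw lj ljS i Logic.I; rewrite /= !mxE.
- move=> x V cx oV Vx.
  have : within paths (nbhs x) V.
    by apply: filterS (open_nbhs_nbhs (conj oV Vx)) => y.
  move=> /(metrizes_nbhs metrizes_sup_dist V cx)[e e0 xV].
  have e5 : 0 < e / 5 by rewrite divr_gt0.
  have [m me] := exists_inv_nat e5.
  have m0 : 0 < m.+1%:R^-1 :> R by rewrite invr_gt0.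
  have [dl dl0 xdl] := path_uniformly_continuous cx m0.
  have [k kdl] : exists k : nat, S / k.+1%:R < dl.
    have [k kd] := exists_inv_nat (divr_gt0 dl0 S0); exists k.
    by rewrite mulrC -ltr_pdivlMr.
  have [a xa] : exists a : nat -> 'rV[int]_n, forall j,
      `|x (grid_time k j) - grid_row m (a j)| <= m.+1%:R^-1.
    by have [a xa] := choice (fun j => grid_row_dense m (x (grid_time k j))); exists a.
  have Bx : B (m, k, mkseq a k.+2) x.
    move=> lj /= ljS; set t := grid_time _ _.
    have [ck cS ct] := cellP k ljS.
    have -> : step (m, k, mkseq a k.+2) t = grid_row m (a (cell k t)).
      by rewrite /step; congr grid_row; exact: nth_mkseq.
    rewrite (le_trans (ler_distD (x (grid_time k (cell k t))) _ _))//.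
    rewrite mulr2n mulrDr mulr1 lerD//; apply: xdl => //.
    exact: le_lt_trans ct kdl.
  exists (m, k, mkseq a k.+2); split=> // y cy By; apply: xV => //.
  apply: (@le_lt_trans _ _ (m.+1%:R^-1 * 4)); last first.
    by move: e0 me; set z := m.+1%:R^-1; lra.
  apply: sup_norm_le => t tS; apply/ler_addgt0Pr => r r0.
  have := continuous_pathsB cx cy.
  move=> /within_continuous_normP /(_ t); rewrite /= in_itv => /(_ tS _ r0).
  move=> [dr dr0 hdr].
  have [l ldr] : exists l : nat, S / l.+1%:R < dr.
    have [l ld] := exists_inv_nat (divr_gt0 dr0 S0); exists l.
    by rewrite mulrC -ltr_pdivlMr.
  have [cl clS ct] := cellP l tS.
  set s := grid_time l (cell l t) in clS ct.
  have ys := By (l, cell l t) clS; rewrite /= -/s in ys.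
  have ts : `|x t - y t - (x s - y s)| <= r.
    by apply: hdr; [rewrite in_itv|exact: le_lt_trans ct ldr].
  have lS : 0 <= grid_time l (cell l t) <= S by [].
  have xs : `|x s - step (m, k, mkseq a k.+2) s| <= m.+1%:R^-1 * 2.
    exact: Bx (l, cell l t) lS.
  rewrite -(subrK (x s - y s) (x t - y t)) (le_trans (ler_normD _ _))//.
  rewrite addrC lerD//; apply: le_trans (ler_distD (step (m, k, mkseq a k.+2) s) _ _) _.
  rewrite [X in _ + X]distrC; apply: le_trans (lerD xs ys) _; rewrite -mulrDr -natrD.
  exact: lexx.
Qed.

End path_space_metric.

(** * Limits in distribution of the solution *)

Section limits.
Context {R : realType}.

Lemma div_cvg_pinfty (t : R) : 0 < t -> t / e @[e --> 0^'+] --> +oo.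
Proof.
move=> t0 A [m [_ mA]].
suff : \forall e \near (0 : R)^'+, m < t / e by apply: filterS => e; exact: mA.
near=> e; have e0 : 0 < e by near: e; exact: nbhs_right_gt.
have m1 : 0 < `|m| + 1 by rewrite ltr_wpDl.
have : e <= t / (`|m| + 1) by near: e; apply: nbhs_right_le; rewrite divr_gt0.
rewrite ler_pdivlMr// => em; rewrite ltr_pdivlMr//.
apply: lt_le_trans em; rewrite mulrC ltr_pM2l//.
by rewrite (le_lt_trans (ler_norm _))// ltrDl.
Unshelve. all: by end_near. Qed.

Lemma cvg_in_distribution_filter {I J : Type} (F : set_system I)
    (G : set_system J) (th : J -> I) (T : topologicalType) (C : set T)
    d (Om : measurableType d) (P : probability Om R) (X : I -> Om -> T)
    d' (Om' : measurableType d') (P' : probability Om' R) (Y : Om' -> T) :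
  th @ G --> F -> cvg_in_distribution C F P X P' Y ->
  cvg_in_distribution C G P (fun j => X (th j)) P' Y.
Proof.
move=> thF [rX rY cX]; split=> //; first exact: thF rX.
by move=> h ch hK; apply: cvg_comp thF (cX h ch hK).
Qed.

Lemma expectation_sum d (Om : measurableType d) (P : probability Om R)
    (I : Type) (K : R) (s : seq I) (h : I -> Om -> R) :
  (forall i, measurable_fun [set: Om] (h i)) -> (forall i w, `|h i w| <= K) ->
  \int[P]_w (\sum_(i <- s) h i w) = \sum_(i <- s) \int[P]_w h i w.
Proof.
move=> mh hK; elim: s => [|i s IH].
  by under eq_Rintegral do rewrite big_nil; rewrite big_nil Rintegral_cst// mul0r.
under eq_Rintegral do rewrite big_cons.
rewrite big_cons RintegralD//; first by rewrite IH.
- exact: (@bounded_integrable_probability _ _ _ _ _ K).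
- apply: (@bounded_integrable_probability _ _ _ _ _ (\sum_(i <- s) K)).
    exact: measurable_sum.
  by move=> w; rewrite (le_trans (ler_norm_sum _ _ _))//; exact: ler_sum.
Qed.

Lemma cvg_sum0 {J I : Type} (F : set_system J) {FF : Filter F} (s : seq I)
    (u : I -> J -> R) : (forall i, u i j @[j --> F] --> 0) ->
  \sum_(i <- s) u i j @[j --> F] --> 0.
Proof.
move=> u0; elim: s => [|i s IH].
  rewrite (_ : (fun j => _) = cst 0); first exact: cvg_cst.
  by apply/funext => j; rewrite big_nil.
rewrite (_ : (fun j => _) = (fun j => u i j + \sum_(k <- s) u k j)).
  by have := cvgD (u0 i) IH; rewrite addr0; exact.
by apply/funext => j; rewrite big_cons.
Qed.

Lemma le_min1_sup (D : R -> R) (S r : R) : 0 <= S ->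
  (forall t, 0 <= t <= S -> D t <= r) \/ 1 <= r ->
  Num.min 1 (sup [set D t | t in `[0, S]]) <= Num.min 1 r.
Proof.
move=> S0 [Dr|r1]; last by rewrite [leRHS]min_l// ge_min lexx.
rewrite le_min ge_min lexx/= ge_min; apply/orP; right.
apply: sup_le_ub; first by exists (D 0), 0 => //=; rewrite in_itv/= lexx.
by move=> y [t /=]; rewrite in_itv/= => tS <-; exact: Dr.
Qed.

End limits.

Section limit_theorems.
Context {R : realType} {n : nat} {d : measure_display} {M : measurableType d}.
Local Notation leb := (@lebesgue_measure R).
Variables (nu : {measure set M -> \bar R}) (phi : R -> M -> M).
Hypothesis hphi : is_flow phi.
Hypothesis nu_sigma_finite : sigma_finite [set: M] nu.
Hypothesis nu_infinite : nu [set: M] = +oo%E.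
Hypothesis phi_preserving : measure_preserving phi nu.
Hypothesis phi_ergodic : ergodic phi nu.
Variables (x0 : 'rV[R]_n) (f : 'rV[R]_n -> M -> 'rV[R]_n) (Kb Kl : R).
Hypothesis f_measurable : measurable_fun [set: borel 'rV[R]_n * M]
  (fun p => f p.1 p.2 : borel 'rV[R]_n).
Hypothesis f_bounded : forall x w, `|f x w| <= Kb.
Hypothesis f_lipschitz : forall w x y, `|f x w - f y w| <= Kl * `|x - y|.
Hypothesis Kl0 : 0 <= Kl.
Hypothesis f_integrable :
  forall x i, nu.-integrable [set: M] (fun w => (f x w ord0 i)%:E).
Hypothesis f_lipschitz_integrable :
  nu.-integrable [set: M] (fun w => (lipschitz_constant (f ^~ w))%:E).
Variable X : R -> R -> M -> 'rV[R]_n.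
Hypothesis X_solution : forall e w, 0 < e ->
  ode_solution (fun t x => f x (phi (t / e) w)) x0 (fun t => X e t w).

Let mf x i : measurable_fun [set: M] (fun w => f x w ord0 i).
Proof. by apply/measurable_EFinP; exact: measurable_int (f_integrable x i). Qed.

Let mlip : measurable_fun [set: M] (fun w => lipschitz_constant (f ^~ w)).
Proof. by apply/measurable_EFinP; exact: measurable_int f_lipschitz_integrable. Qed.

Local Notation averaged := (averaged phi f x0).
Local Notation lip_mass := (lip_mass phi f).

Let lip0 e T w : 0 <= lip_mass e T w.
Proof. exact: (lip_mass_ge0 phi f_lipschitz). Qed.

(** The second alternative is the case lip_mass > 1 / 2. Because of the
    summand 1 in Q + 1, both alternatives bound the error truncated at 1 by
    the same quantity. *)
Lemma scaled_averaging_error e T c Q w : 0 < e -> 0 <= T -> 0 < c ->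
  (forall t, 0 <= t <= T -> c * `|averaged e t w| <= Q) ->
  (forall t, 0 <= t <= T ->
     `|c *: (X e t w - x0) - c *: averaged e t w| <= 2 * lip_mass e T w * (Q + 1))
  \/ 1 <= 2 * lip_mass e T w * (Q + 1).
Proof.
move=> e0 T0 c0 aQ.
have h0 : (0 : R) <= 0 <= T by rewrite lexx.
have Q0 : 0 <= Q by apply: le_trans (aQ 0 h0); rewrite mulr_ge0// ltW.
have d0 := lip0 e T w.
have [dl|dg] := leP (lip_mass e T w) 2^-1; [left|right].
  have aS t : 0 <= t <= T -> `|averaged e t w| <= Q / c.
    by move=> tT; rewrite ler_pdivlMr// mulrC aQ.
  move=> t tT; rewrite -scalerBr normrZ gtr0_norm//.
  have := averaging_error hphi mf f_bounded f_lipschitz Kl0 mlip X_solution e0 T0 dl aS tT.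
  rewrite mulrA ler_pdivlMr// mulrC => /le_trans; apply.
  by rewrite ler_wpM2l ?mulr_ge0// lerDl.
have : 1 <= 2 * lip_mass e T w by lra.
by move=> h; apply: le_trans h _; rewrite ler_peMr ?mulr_ge0// lerDr.
Qed.

Let expectation_twice_lip_mass (mu : probability M R) T : mu `<< nu -> 0 < T ->
  \int[mu]_w (2 * lip_mass e T w) @[e --> 0^'+] --> 0.
Proof.
move=> munu T0.
have H := expectation_lip_mass_cvg0 hphi f_lipschitz Kl0 mlip nu_sigma_finite
  nu_infinite phi_preserving phi_ergodic f_lipschitz_integrable munu T0.
rewrite -[X in _ --> X](mulr0 2).
apply: cvg_trans (cvgMr (a := 2) H); apply: near_eq_cvg; near=> e.
have e0 : 0 < e by near: e; exact: nbhs_right_gt.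
rewrite RintegralZl//; apply: (@bounded_integrable_probability _ _ _ _ _ (Kl * T)).
  by apply: (measurable_lip_mass hphi f_lipschitz Kl0 mlip e0); exact: ltW.
move=> w; rewrite ger0_norm//.
by apply: (lip_mass_le hphi f_lipschitz Kl0 mlip); exact: ltW.
Unshelve. all: by end_near. Qed.

Let twice_lip_mass_bounded T : 0 < T -> \forall e \near 0^'+,
  measurable_fun [set: M] (fun w => 2 * lip_mass e T w) /\
  forall w, 0 <= 2 * lip_mass e T w <= 2 * (Kl * T).
Proof.
move=> T0; near=> e; have e0 : 0 < e by near: e; exact: nbhs_right_gt.
split.
  apply: measurable_funM => //.
  by apply: (measurable_lip_mass hphi f_lipschitz Kl0 mlip e0); exact: ltW.
move=> w; rewrite mulr_ge0//= ler_wpM2l//.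
by apply: (lip_mass_le hphi f_lipschitz Kl0 mlip); exact: ltW.
Unshelve. all: by end_near. Qed.

(** The error on the rescaled path is at most 2 * lip_mass times the
    supremum of the rescaled integral process, which converges in
    distribution as a continuous function of this process. *)
Lemma strong_cvg_solution_path (a : R -> R) (d' : measure_display)
    (Om : measurableType d') (P : probability Om R) (Z : R -> Om -> 'rV[R]_n) S :
  (forall e, 0 < e -> 0 < a e) -> 0 < S ->
  strong_cvg_in_distribution_unif S 0^'+ nu
    (fun e t w => a e *:
       vintegral leb `[0, t / e] (fun s => f x0 (phi s w))) P Z ->
  strong_cvg_in_distribution_unif S 0^'+ nu
    (fun e t w => (a e / e) *: (X e t w - x0)) P Z.
Proof.
move=> a0 S0 VZ mu munu; have {}VZ := VZ mu munu.
set V := (fun (e : R) (w : M) (t : R) => _) in VZ.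
have VE e t w : 0 < e -> V e w t = (a e / e) *: averaged e t w.
  move=> e0; rewrite (averagedE hphi x0 mf f_bounded t w e0) scalerA.
  by rewrite mulfVK// gt_eqF.
have Vpath : \forall e \near (0 : R)^'+, random_element (@continuous_paths R n S) (V e).
  by case: VZ.
have QV : cvg_in_distribution [set: R] 0^'+ mu (fun e w => sup_norm S (V e w)) P
    (fun v => sup_norm S (Z ^~ v)).
  exact: cvg_in_distribution_comp (continuous_sup_norm S0) _ VZ.
have Q0 : \forall e \near (0 : R)^'+, forall w, 0 <= sup_norm S (V e w).
  apply: filterS Vpath => e [Vp _] w.
  apply: le_trans (normr_ge0 (V e w 0)) (le_sup_norm (Vp w) _).
  by rewrite lexx ltW.
have r0 : \int[mu]_w Num.min 1 (2 * lip_mass e S w * (sup_norm S (V e w) + 1))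
    @[e --> 0^'+] --> 0.
  exact: tight_mul_cvg0 (twice_lip_mass_bounded S0)
    (expectation_twice_lip_mass munu S0) Q0 QV.
apply: slutsky (metrizes_sup_dist S0) VZ _ _ r0.
- near=> e; have e0 : 0 < e by near: e; exact: nbhs_right_gt.
  have ae0 : 0 < a e / e by rewrite divr_gt0// a0.
  apply: random_element_path => //.
    move=> w; apply/within_continuous_normP => s; rewrite /= in_itv/= => /andP[s0 sS] r rr0.
    have Kc : 0 < a e / e * Kb + 1.
      have Kb0 : 0 <= Kb := le_trans (normr_ge0 _) (f_bounded x0 w).
      by rewrite ltr_wpDl// mulr_ge0// ltW.
    exists (r / (a e / e * Kb + 1)); first by rewrite divr_gt0.
    have lip u v : 0 <= u -> u <= v -> `|X e v w - X e u w| <= Kb * `|v - u|.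
      move=> u0 uv; rewrite [`|v - u|]ger0_norm ?subr_ge0//.
      exact: (solution_displacement f_bounded X_solution).
    move=> t; rewrite in_itv/= => /andP[t0 tS] st.
    rewrite -scalerBr normrZ (gtr0_norm ae0) opprB addrA subrK.
    have Xst : `|X e s w - X e t w| <= Kb * `|s - t|.
      have [st'|ts'] := leP s t; last exact/lip/ltW.
      by rewrite distrC [`|s - t|]distrC; exact: lip.
    apply: (@le_trans _ _ (a e / e * (Kb * `|s - t|))).
      by rewrite ler_wpM2l// ltW.
    rewrite mulrA; move: st; rewrite ltr_pdivlMr// mulrC => /ltW; apply: le_trans.
    by rewrite ler_wpM2r// lerDl.
  move=> t i /andP[t0 tS].
  rewrite (_ : (fun w => _) = (fun w => (a e / e) * (X e t w ord0 i - x0 ord0 i))).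
    apply: measurable_funM => //; apply: measurable_funB => //.
    exact: (measurable_solution hphi f_measurable f_bounded f_lipschitz Kl0 X_solution).
  by apply/funext => w; rewrite !mxE.
- near=> e; have e0 : 0 < e by near: e; exact: nbhs_right_gt.
  have ae0 : 0 < a e / e by rewrite divr_gt0// a0.
  have Ve : random_element (@continuous_paths R n S) (V e) by near: e.
  split.
    have [mdl _] : measurable_fun [set: M] (fun w => 2 * lip_mass e S w) /\
      forall w, 0 <= 2 * lip_mass e S w <= 2 * (Kl * S).
      by near: e; exact: twice_lip_mass_bounded.
    apply: measurable_minr => //; apply: measurable_funM => //.
    apply: measurable_funD => //.
    exact: measurable_fun_random_element Ve (continuous_sup_norm S0).
  move=> w; rewrite [X in _ && X]ge_min lexx andbT.
  apply: le_min1_sup; first exact: ltW.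
  have aQ t : 0 <= t <= S -> a e / e * `|averaged e t w| <= sup_norm S (V e w).
    move=> tS; rewrite -(gtr0_norm ae0) -normrZ -VE//.
    exact: (le_sup_norm (Ve.1 w)).
  have [H|H] := scaled_averaging_error e0 (ltW S0) ae0 aQ; [left|by right].
  by move=> t tS; rewrite VE//; exact: H.
Unshelve. all: by end_near. Qed.

(** The normalized indicator function of a set of positive finite measure. *)
Lemma exists_integral1 : exists g : M -> R, [/\ measurable_fun [set: M] g,
  exists K, forall w, `|g w| <= K, nu.-integrable [set: M] (EFin \o g) &
  \int[nu]_w g w = 1].
Proof.
have [A [mA A0 Aoo]] : exists A : set M,
    [/\ measurable A, (0 < nu A)%E & (nu A < +oo)%E].
  have [F FM mF] := nu_sigma_finite; apply: contrapT => noA.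
  have F0 k : nu (F k) = 0%E.
    have [mFk Fkoo] := mF k; apply/eqP; rewrite eq_le measure_ge0 andbT leNgt.
    by apply/negP => Fk0; apply: noA; exists (F k).
  have : nu.-negligible [set: M].
    rewrite FM; apply: negligible_bigcup => k.
    by apply/negligibleP; [exact: (mF k).1|exact: F0].
  move/negligibleP => /(_ measurableT) nuT.
  by have := etrans (esym nuT) nu_infinite.
have nuA : (fine (nu A))%:E = nu A by rewrite fineK// ge0_fin_numE.
have a0 : 0 < fine (nu A) by rewrite fine_gt0// A0.
have mA1 : measurable_fun [set: M] (\1_A : M -> R) by exact: measurable_indic.
have intA : nu.-integrable [set: M] (EFin \o (\1_A : M -> R)).
  apply/integrableP; split; first exact/measurable_EFinP.
  under eq_integral do rewrite /= ger0_norm//.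
  by rewrite integral_indic// setIT.
exists (fun w => (fine (nu A))^-1 * \1_A w); split.
- exact: measurable_funM.
- exists (fine (nu A))^-1 => w; rewrite normrM gtr0_norm ?invr_gt0//.
  by rewrite ler_piMr ?invr_ge0 ?(ltW a0)// indicE; case: (_ \in _); rewrite ?normr1 ?normr0.
- rewrite (_ : _ \o _ = (fun w => (fine (nu A))^-1%:E * (\1_A w)%:E)%E).
    exact: integrableZl.
  by apply/funext => w; rewrite /= EFinM.
- rewrite RintegralZl// /Rintegral integral_indic// setIT.
  by rewrite mulVf// gt_eqF.
Qed.

(** Let g0 be a function of integral 1 and c the integral of f x0. Each
    coordinate of f x0 - g0 * c has integral 0, so that its normalized orbit
    integral tends to 0 in distribution, hence in probability. The
    normalized integral of f x0 along the orbit is thus asymptotic to the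
    scalar integral of g0 times the vector c. The averaging error involves
    the supremum over [0, t] of the integrals of f x0; it is bounded by the
    integral Q of the sum G of the absolute values of the coordinates, which
    converges in distribution by hypothesis. *)
Lemma strong_cvg_solution_at (b : R -> R) (d' : measure_display)
    (Om : measurableType d') (P : probability Om R) (Y : {RV P >-> R}) :
  (forall t, 0 < t -> 0 < b t) ->
  (forall g : M -> R, nu.-integrable [set: M] (EFin \o g) ->
    strong_cvg_in_distribution [set: R] (pinfty_nbhs R) nu
      (fun t w => b t * \int[leb]_(s in `[0, t]) g (phi s w))
      P (fun v => (\int[nu]_w g w) * Y v)) ->
  forall t : R, 0 < t ->
    strong_cvg_in_distribution [set: 'rV[R]_n] 0^'+ nu
      (fun e w => (b (t / e) / e) *: (X e t w - x0))
      P (fun v => Y v *: vintegral nu setT (f x0)).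
Proof.
move=> b0 bY t t0 mu munu.
have along (g : M -> R) : nu.-integrable [set: M] (EFin \o g) ->
    cvg_in_distribution [set: R] 0^'+ mu
      (fun e w => b (t / e) * orbit_integral phi g (t / e) w)
      P (fun v => (\int[nu]_w g w) * Y v).
  move=> intg; have H := bY g intg mu munu.
  exact: (cvg_in_distribution_filter (div_cvg_pinfty t0) H).
have [g0 [mg0 [K0 g0K] intg0 g01]] := exists_integral1.
pose c := vintegral nu setT (f x0).
have cE i : c ord0 i = \int[nu]_w f x0 w ord0 i by rewrite /c mxE.
pose N i w := f x0 w ord0 i - c ord0 i * g0 w.
have intcg i : nu.-integrable [set: M] (EFin \o (fun w => c ord0 i * g0 w)).
  rewrite (_ : _ \o _ = (fun w => (c ord0 i)%:E * (g0 w)%:E)%E); first exact: integrableZl.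
  by apply/funext => w; rewrite /= EFinM.
have intN i : nu.-integrable [set: M] (EFin \o N i).
  rewrite (_ : _ \o _ = (fun w => (f x0 w ord0 i)%:E - (c ord0 i * g0 w)%:E)%E).
    exact: integrableB (f_integrable x0 i) (intcg i).
  by apply/funext => w; rewrite /= EFinB.
have N0 i : \int[nu]_w N i w = 0.
  rewrite /N RintegralB; [|by []|exact: f_integrable|exact: intcg].
  by rewrite RintegralZl// g01 mulr1 cE subrr.
have mN i : measurable_fun [set: M] (N i).
  by apply/measurable_EFinP; exact: measurable_int (intN i).
have Nbd i w : `|N i w| <= Kb + `|c ord0 i| * K0.
  rewrite (le_trans (ler_normB _ _))// lerD//.
    exact: le_trans (le_row_normr _ _) (f_bounded _ _).
  by rewrite normrM ler_wpM2l.
pose V e w := (b (t / e) / e) *: averaged e t w.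
have VE e w i : 0 < e -> V e w ord0 i =
    b (t / e) * orbit_integral phi (fun w => f x0 w ord0 i) (t / e) w.
  move=> e0; rewrite /V (averagedE hphi x0 mf f_bounded t w e0) scalerA.
  by rewrite mulfVK ?gt_eqF// !mxE.
have mV : \forall e \near (0 : R)^'+, random_element [set: 'rV[R]_n] (V e).
  near=> e; have e0 : 0 < e by near: e; exact: nbhs_right_gt.
  apply: random_element_row => i.
  rewrite (_ : (fun w => _) = (fun w => b (t / e) *
      orbit_integral phi (fun w => f x0 w ord0 i) (t / e) w)).
    apply: measurable_funM => //.
    apply: (measurable_orbit_integral (K := Kb) hphi) => //.
      by move=> w; exact: le_trans (le_row_normr _ _) (f_bounded _ _).
    by rewrite divr_ge0// ltW.
  by apply/funext => w; exact: VE.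
have Uc : cvg_in_distribution [set: 'rV[R]_n] 0^'+ mu
    (fun e w => (b (t / e) * orbit_integral phi g0 (t / e) w) *: c) P
    (fun v => (\int[nu]_w g0 w * Y v) *: c).
  apply: (cvg_in_distribution_comp (g := fun u : R => u *: c) _ _ (along g0 intg0)) => //.
  by apply/continuous_subspaceT => u; apply: cvgZr_tmp; exact: cvg_id.
pose err i e w := Num.min 1 `|b (t / e) * orbit_integral phi (N i) (t / e) w|.
have min1_cont : {within [set: R], continuous (fun x : R => Num.min 1 `|x|)}.
  apply/continuous_subspaceT => q.
  apply: (@continuous_min _ _ (cst 1) (fun q : R => `|q|) q); first exact: cvg_cst.
  by apply: cvg_norm; exact: cvg_id.
have min1_bd (x : R) : `|Num.min 1 `|x| | <= 1.
  by rewrite ger0_norm ?ge_min ?lexx// le_min ler01 normr_ge0.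
have err_cvg i : \int[mu]_w err i e w @[e --> 0^'+] --> 0.
  have [_ _ H] := along _ (intN i).
  have := H _ min1_cont (ex_intro (fun K => forall x, setT x -> `|Num.min 1 `|x| | <= K)
    1 (fun x _ => min1_bd x)).
  rewrite N0 (_ : \int[P]_v _ = 0)//.
  under eq_Rintegral do rewrite mul0r normr0 min_r//.
  by rewrite Rintegral_cst// mul0r.
have merr i : \forall e \near (0 : R)^'+, measurable_fun [set: M] (err i e).
  have [rN _ _] := along _ (intN i).
  by apply: filterS rN => e rNe; exact: measurable_fun_random_element rNe min1_cont.
pose r1 e w := Num.min 1 (\sum_i err i e w).
have err01 i e w : 0 <= err i e w <= 1.
  by rewrite /err le_min ler01 normr_ge0 ge_min lexx.
have merr_all : \forall e \near (0 : R)^'+, forall i, measurable_fun [set: M] (err i e).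
  by apply: filter_forall => i; exact: merr.
have r1_cvg : \int[mu]_w r1 e w @[e --> 0^'+] --> 0.
  have S0 : (\sum_i \int[mu]_w err i e w) @[e --> 0^'+] --> (0 : R).
    exact: cvg_sum0.
  apply: squeeze_cvgr (cvg_cst 0) S0; near=> e.
  have me i : measurable_fun [set: M] (err i e) by move: i; near: e.
  apply/andP; split.
    apply: Rintegral_ge0 => w _; rewrite le_min ler01 sumr_ge0// => i _.
    by have /andP[] := err01 i e w.
  rewrite -(@expectation_sum _ _ _ _ _ 1)//; last first.
    by move=> i w; have /andP[? ?] := err01 i e w; rewrite ger0_norm.
  apply: (@le_expectation _ _ _ _ _ _ 1 n%:R).
  - by apply: measurable_minr => //; exact: measurable_sum.
  - move=> w; rewrite ger0_norm ?ge_min ?lexx// le_min ler01 sumr_ge0// => i _.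
    by have /andP[] := err01 i e w.
  - exact: measurable_sum.
  - move=> w; rewrite (le_trans (ler_norm_sum _ _ _))//.
    rewrite -[n in leRHS]card_ord -sumr_const; apply: ler_sum => i _.
    by have /andP[? ?] := err01 i e w; rewrite ger0_norm.
  - by move=> w; rewrite ge_min lexx orbT.
have Vc : cvg_in_distribution [set: 'rV[R]_n] 0^'+ mu V P (fun v => Y v *: c).
  have YE : (fun v => (\int[nu]_w g0 w * Y v) *: c) = (fun v => Y v *: c).
    by apply/funext => v; rewrite g01 mul1r.
  rewrite YE in Uc.
  apply: slutsky (metrizes_norm [set: 'rV[R]_n]) Uc mV _ r1_cvg.
  near=> e; have e0 : 0 < e by near: e; exact: nbhs_right_gt.
  have me i : measurable_fun [set: M] (err i e) by move: i; near: e.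
  split; first by apply: measurable_minr => //; exact: measurable_sum.
  move=> w; rewrite [X in _ && X]ge_min lexx andbT.
  have coordE i : (V e w - (b (t / e) * orbit_integral phi g0 (t / e) w) *: c) ord0 i =
      b (t / e) * orbit_integral phi (N i) (t / e) w.
    have mfs := measurable_along_orbit hphi w (mf x0 i).
    have mgs := measurable_along_orbit hphi w mg0.
    have fb x : `|f x0 (phi x w) ord0 i| <= Kb.
      exact: le_trans (le_row_normr _ _) (f_bounded _ _).
    have -> : orbit_integral phi (N i) (t / e) w =
        orbit_integral phi (fun w => f x0 w ord0 i) (t / e) w -
        c ord0 i * orbit_integral phi g0 (t / e) w.
      rewrite /orbit_integral /N RintegralB//; last 2 first.
      - exact: bounded_integrable_itv mfs fb.
      - apply: (bounded_integrable_itv (K := `|c ord0 i| * K0)).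
          exact: measurable_funM.
        by move=> x; rewrite normrM ler_wpM2l.
      rewrite RintegralZl//.
      by apply: (bounded_integrable_itv (K := K0)).
    rewrite mxE [X in _ + X]mxE [X in - X]mxE VE//.
    by rewrite mulrBr -mulrA [_ * c _ _]mulrC.
  have [s1|s1] := leP 1 (\sum_i err i e w); first by rewrite [leRHS]min_l// ge_min lexx.
  rewrite /r1 le_min ge_min lexx/= ge_min; apply/orP; right.
  apply: normr_row_le => [|i].
    by rewrite sumr_ge0// => i _; have /andP[] := err01 i e w.
  have : err i e w <= \sum_i err i e w.
    rewrite (bigD1 i)//= lerDl sumr_ge0// => j _.
    by have /andP[] := err01 j e w.
  rewrite {1}/err ge_min coordE => /orP[|//].
  by rewrite leNgt s1.
pose G w := \sum_i `|f x0 w ord0 i|.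
have mG : measurable_fun [set: M] G.
  by apply: measurable_sum => i; exact: measurableT_comp.
have GK w : `|G w| <= n%:R * Kb.
  rewrite mulr_natl -[n in leRHS]card_ord -sumr_const.
  rewrite (le_trans (ler_norm_sum _ _ _))//; apply: ler_sum => i _.
  by rewrite normr_id; exact: le_trans (le_row_normr _ _) (f_bounded _ _).
have G0 w : 0 <= G w by apply: sumr_ge0.
have intG : nu.-integrable [set: M] (EFin \o G).
  rewrite (_ : _ \o _ = (fun w => \sum_i (`|f x0 w ord0 i|)%:E)%E).
    by apply: integrable_sum => // i _; exact: (integrable_norm (f_integrable x0 i)).
  by apply/funext => w; rewrite /= sumEFin.
pose Q e w := b (t / e) * orbit_integral phi G (t / e) w.
have Q0 : \forall e \near (0 : R)^'+, forall w, 0 <= Q e w.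
  near=> e => w; have e0 : 0 < e by near: e; exact: nbhs_right_gt.
  by rewrite mulr_ge0 ?orbit_integral_ge0// ltW// b0// divr_gt0.
have r2_cvg : \int[mu]_w Num.min 1 (2 * lip_mass e t w * (Q e w + 1))
    @[e --> 0^'+] --> 0.
  exact: tight_mul_cvg0 (twice_lip_mass_bounded t0)
    (expectation_twice_lip_mass munu t0) Q0 (along G intG).
apply: slutsky (metrizes_norm [set: 'rV[R]_n]) Vc _ _ r2_cvg.
- near=> e; have e0 : 0 < e by near: e; exact: nbhs_right_gt.
  apply: random_element_row => i.
  rewrite (_ : (fun w => _) = (fun w => (b (t / e) / e) * (X e t w ord0 i - x0 ord0 i))).
    apply: measurable_funM => //; apply: measurable_funB => //.
    apply: (measurable_solution hphi f_measurable f_bounded f_lipschitz Kl0 X_solution) => //.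
    exact: ltW.
  by apply/funext => w; rewrite !mxE.
near=> e; have e0 : 0 < e by near: e; exact: nbhs_right_gt.
have te0 : 0 < t / e by rewrite divr_gt0.
have be0 : 0 < b (t / e) / e by rewrite divr_gt0// b0.
split.
  have [mdl _] : measurable_fun [set: M] (fun w => 2 * lip_mass e t w) /\
    forall w, 0 <= 2 * lip_mass e t w <= 2 * (Kl * t).
    by near: e; exact: twice_lip_mass_bounded.
  apply: measurable_minr => //; apply: measurable_funM => //.
  apply: measurable_funD => //; apply: measurable_funM => //.
  exact: (measurable_orbit_integral hphi mG GK (ltW te0)).
move=> w; rewrite [X in _ && X]ge_min lexx andbT.
have aQ s : 0 <= s <= t -> b (t / e) / e * `|averaged e s w| <= Q e w.
  move=> /andP[s0 st]; have se0 : 0 <= s / e by rewrite divr_ge0// ltW.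
  rewrite (averagedE hphi x0 mf f_bounded s w e0) normrZ (gtr0_norm e0) mulrA.
  rewrite mulfVK ?gt_eqF// ler_wpM2l ?(ltW (b0 _ te0))//.
  apply: (@le_trans _ _ (orbit_integral phi G (s / e) w)); last first.
    apply: (le_orbit_integral hphi mG GK G0) => //.
    by rewrite ler_wpM2r// invr_ge0 ltW.
  apply: normr_row_le => [|i]; first exact: orbit_integral_ge0.
  rewrite mxE.
  have mfs := measurable_along_orbit hphi w (mf x0 i).
  have fb x : `|f x0 (phi x w) ord0 i| <= Kb.
    exact: le_trans (le_row_normr _ _) (f_bounded _ _).
  apply: le_trans (le_normr_Rintegral _ (bounded_integrable_itv _ _ mfs fb)) _ => //.
  apply: le_Rintegral => //.
  - apply: (bounded_integrable_itv (K := Kb)); first exact: measurableT_comp.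
    by move=> x; rewrite normr_id.
  - apply: (bounded_integrable_itv (K := n%:R * Kb)) => //.
    exact: measurable_along_orbit.
  - by move=> x _; rewrite /G (bigD1 i)//= lerDl sumr_ge0.
have tt : 0 <= t <= t by rewrite lexx ltW.
have [H|H] := scaled_averaging_error e0 (ltW t0) be0 aQ; last first.
  by rewrite [leRHS]min_l// ge_min lexx.
rewrite le_min ge_min lexx/= ge_min; apply/orP; right; exact: (H _ tt).
Unshelve. all: by end_near.
Qed.

End limit_theorems.

Theorem theorem3p1 (R : realType) (n : nat) (d : measure_display)
    (M : measurableType d) (nu : {measure set M -> \bar R})
    (phi : R -> M -> M)
    (hphi : is_flow phi)
    (nu_sigma_finite : sigma_finite [set: M] nu)
    (nu_infinite : nu [set: M] = +oo%E)
    (phi_preserving : measure_preserving phi nu)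
    (phi_conservative : conservative phi nu)
    (phi_ergodic : ergodic phi nu)
    (x0 : 'rV[R]_n)
    (f : 'rV[R]_n -> M -> 'rV[R]_n)
    (f_measurable :
      measurable_fun [set: borel 'rV[R]_n * M]
        (fun p => f p.1 p.2 : borel 'rV[R]_n))
    (f_bounded : exists K : R, forall x w, `|f x w| <= K)
    (f_lipschitz :
      exists K : R, forall w x y, `|f x w - f y w| <= K * `|x - y|)
    (f_integrable :
      forall x i, nu.-integrable [set: M] (fun w => (f x w ord0 i)%:E))
    (f_lipschitz_integrable :
      nu.-integrable [set: M] (fun w => (lipschitz_constant (f ^~ w))%:E))
    (X : R -> R -> M -> 'rV[R]_n)
    (X_solution : forall e w, 0 < e ->
      ode_solution (fun t x => f x (phi (t / e) w)) x0 (fun t => X e t w)) :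
  [/\ forall T : R, 0 < T ->
      {ae nu, forall w,
        (fun e : R => sup [set `|X e t w - x0
            - vintegral lebesgue_measure `[0, t] (fun s => f x0 (phi (s / e) w))|
          | t in `[0, T]])
        =o_ (0^'+)
        (fun e : R => sup [set
            `|vintegral lebesgue_measure `[0, t] (fun s => f x0 (phi (s / e) w))|
          | t in `[0, T]])},
      forall (b : R -> R) (d' : measure_display) (Om : measurableType d')
        (P : probability Om R) (Y : {RV P >-> R}),
      (forall t, 0 < t -> 0 < b t) ->
      nondegenerate_RV P Y ->
      (forall g : M -> R, nu.-integrable [set: M] (EFin \o g) ->
        strong_cvg_in_distribution [set: R] (pinfty_nbhs R) nu
          (fun t w => b t * \int[lebesgue_measure]_(s in `[0, t]) g (phi s w))
          P (fun v => (\int[nu]_w g w) * Y v)) ->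
      forall t : R, 0 < t ->
        strong_cvg_in_distribution [set: 'rV[R]_n] 0^'+ nu
          (fun e w => (b (t / e) / e) *: (X e t w - x0))
          P (fun v => Y v *: vintegral nu setT (f x0))
    & forall (a : R -> R) (d' : measure_display) (Om : measurableType d')
        (P : probability Om R) (Z : R -> Om -> 'rV[R]_n),
      (forall e, 0 < e -> 0 < a e) ->
      continuous_process Z ->
      (forall S : R, 0 < S ->
        strong_cvg_in_distribution_unif S 0^'+ nu
          (fun e t w => a e *:
             vintegral lebesgue_measure `[0, t / e] (fun s => f x0 (phi s w)))
          P Z) ->
      forall S : R, 0 < S ->
        strong_cvg_in_distribution_unif S 0^'+ nu
          (fun e t w => (a e / e) *: (X e t w - x0)) P Z].

Proof.
have [Kb fKb] := f_bounded.
have [K fK] := f_lipschitz.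
have fKl w x y : `|f x w - f y w| <= `|K| * `|x - y|.
  by apply: le_trans (fK w x y) _; rewrite ler_wpM2r// ler_norm.
have K0 : 0 <= `|K| by [].
have mf x i : measurable_fun [set: M] (fun w => f x w ord0 i).
  by apply/measurable_EFinP; exact: measurable_int (f_integrable x i).
have mlip : measurable_fun [set: M] (fun w => lipschitz_constant (f ^~ w)).
  by apply/measurable_EFinP; exact: measurable_int f_lipschitz_integrable.
split.
- move=> T T0.
  exact: (averaging_sup_littleo hphi mf fKb fKl K0 mlip X_solution
    nu_sigma_finite nu_infinite phi_preserving phi_ergodic f_lipschitz_integrable T0).
- move=> b d' Om P Y b0 _ bY t t0.
  exact: (strong_cvg_solution_at hphi nu_sigma_finite nu_infinite phi_preserving
    phi_ergodic f_measurable fKb fKl K0 f_integrable f_lipschitz_integrable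
    X_solution b0 bY t0).
- move=> a d' Om P Z a0 _ aZ S S0.
  exact: (strong_cvg_solution_path hphi nu_sigma_finite nu_infinite phi_preserving
    phi_ergodic f_measurable fKb fKl K0 f_integrable f_lipschitz_integrable
    X_solution a0 S0 (aZ S S0)).
Qed.
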